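(* Let $0<\epsilon<1$ and let $x=P(x)$ be a quadratic MPS in $n$ variables with least fixed point $q^*$ satisfying $0<q^*\le\mathbf{1}$. Let $q^*_{\min}=\min_i q^*_i$, let $c_{\min}$ be the minimum nonzero coefficient or constant in $P(x)$, let $\alpha=\min\{1,c_{\min}\}\cdot\tfrac12 q^*_{\min}$, let $d$ be the maximum depth of SCCs in the DAG $H_P$ of strongly connected components of the dependency graph, and let $f$ be the nonlinear depth of $P$. Then the rounded-down decomposed Newton's method (R-DNM) with rounding parameter $$h\ge\left\lceil 3+2^f\cdot\Big(\log\frac1\epsilon+d\cdot\big(\log(\alpha^{-(4n+1)})+\log(16n)+\log\|P(\mathbf{1})\|_\infty\big)\Big)\right\rceil,$$ using $g\ge h-1$ iterations for every nonlinear SCC (and $1$ iteration for every linear SCC), produces an approximation $\tilde q$ with $\tilde q\le q^*$ and $\|q^*-\tilde q\|_\infty\le\epsilon$.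
   Context: An MPS is a system $x=P(x)$ where each coordinate polynomial has nonnegative coefficients and constant term; quadratic means degree at most 2; its least fixed point (LFP) is the coordinatewise least nonnegative solution. Dependency graph $G_P$: nodes are variables, edge $x_i\to x_j$ iff $x_j$ appears in a monomial of $P_i$ with positive coefficient. $H_P$ is the DAG of strongly connected components (SCCs) of $G_P$. For an SCC $S$, let $D(S)$ be the set of variables not in $S$ reachable from $S$ in $G_P$, and write its equations as $x_S=P_S(x_S,x_{D(S)})$. $S$ is linear if $x_S=P_S(x_S,q^*_{D(S)})$ is linear (degree $\le1$) in $x_S$, and nonlinear otherwise. The depth of $H_P$ ($d$) is the maximum over paths in $H_P$ of the number of SCCs on the path; the nonlinear depth ($f$) is the maximum over paths of the number of nonlinear SCCs on the path. Newton operator: $\mathcal{N}_Q(z)=z+(I-B(z))^{-1}(Q(z)-z)$ with $B$ the Jacobian of $Q$. Rounded-down Newton's method (R-NM) with parameter $h$ on $x=Q(x)$: $x^{[0]}=\mathbf{0}$, and $x^{[k+1]}_i$ is the largest nonnegative integer multiple of $2^{-h}$ that is $\le\max(\mathcal{N}_Q(x^{[k]})_i,0)$. R-DNM: process SCCs bottom-up in $H_P$; for SCC $S$, with already computed approximations $\tilde q_{D(S)}$, form $x_S=P_S(x_S,\tilde q_{D(S)})$ and apply $g$ iterations of R-NM with parameter $h$ if $S$ is nonlinear, or one R-NM iteration (i.e. solve the linear system and round down) if $S$ is linear; the result is $\tilde q_S$. Logarithms base 2. *)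

(* Defs.v *)
From HB Require Import structures.
From mathcomp Require Import all_boot all_order all_algebra.
From mathcomp Require Import mpoly.
From mathcomp Require Import reals.
From mathcomp Require exp.

Set Implicit Arguments.
Unset Strict Implicit.
Unset Printing Implicit Defensive.

Import Order.TTheory GRing.Theory Num.Theory.
Local Open Scope ring_scope.

Section Systems.

Variables (R : realType) (n : nat).

Definition system := 'I_n -> {mpoly R[n]}.

Implicit Types (Q : system) (z : 'cV[R]_n).

Definition eval Q z : 'cV[R]_n := \col_i (Q i).@[fun j => z j 0].

Definition jacobian Q z : 'M[R]_n :=
  \matrix_(i, j) ((Q i)^`M(j)).@[fun k => z k 0].

Definition is_MPS Q := forall i m, 0 <= (Q i)@_m.

Definition quadratic Q := forall i, (msize (Q i) <= 3)%N.

Definition is_LFP Q z :=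
  [/\ eval Q z = z,
      forall i, 0 <= z i 0
    & forall y : 'cV[R]_n, eval Q y = y -> (forall i, 0 <= y i 0) ->
        forall i, z i 0 <= y i 0].

Definition norm_oo z : R := \big[Num.max/0]_i `|z i 0|.

(* [invmx] is total, hence the explicit test: a Newton iteration at a point where
   [I - B(z)] is singular must fail rather than return a junk value. *)
Definition newton Q z : option 'cV[R]_n :=
  let M := 1%:M - jacobian Q z in
  if M \in unitmx then Some (z + invmx M *m (eval Q z - z)) else None.

Definition round_down (h : nat) (x : R) : R :=
  (Num.truncn (2 ^+ h * Num.max x 0))%:R / 2 ^+ h.

Definition rnm_step (h : nat) Q z : option 'cV[R]_n :=
  omap (map_mx (round_down h)) (newton Q z).

Definition rnm (h : nat) Q (k : nat) : option 'cV[R]_n :=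
  iter k (obind (rnm_step h Q)) (Some 0).

End Systems.

Section Decomposition.

Variables (R : realType) (n : nat) (P : system R n).

Implicit Types (S T : {set 'I_n}) (y q : 'cV[R]_n).

Definition dep_edge : rel 'I_n := fun i j =>
  has (fun m : 'X_{1..n} => (0 < (P i)@_m) && (0 < m j)%N) (msupp (P i)).

Definition scc_of (i : 'I_n) : {set 'I_n} :=
  [set j | connect dep_edge i j && connect dep_edge j i].

Definition sccs : {set {set 'I_n}} := [set scc_of i | i : 'I_n].

Definition scc_edge : rel {set 'I_n} := fun S T =>
  (S != T) && [exists i in S, exists j in T, dep_edge i j].

Definition scc_path (s : seq {set 'I_n}) : bool :=
  all (mem sccs) s && sorted scc_edge s.

(* A path of the DAG of SCCs has at most [n] nodes (see [size_scc_path]), so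
   bounding the length of the paths by [n] loses none of them. *)
Definition max_on_scc_paths (a : pred {set 'I_n}) : nat :=
  \max_(k < n.+1) \max_(t : k.-tuple {set 'I_n} | scc_path t) count a t.

Definition depth : nat := max_on_scc_paths predT.

Definition scc_index S (j : 'I_n) : option 'I_#|S| :=
  [pick k | enum_val k == j].

(* The system [x_S = P_S(x_S, y_D(S))], as a system in [#|S|] variables.  When
   [S] is an SCC, the variables outside [S] that occur in [P_S] all belong to
   [D(S)], so no other coordinate of [y] is used. *)
Definition subsystem S y : system R #|S| := fun k =>
  P (enum_val k) \mPo
    [tuple if scc_index S j is Some l then 'X_l else (y j 0)%:MP | j < n].
Arguments subsystem : clear implicits.

Definition linear_scc q S : bool :=
  [forall k, (msize (subsystem S q k) <= 2)%N].

Definition nonlinear_depth q : nat :=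
  max_on_scc_paths (fun S => ~~ linear_scc q S).

Definition bottom_up (s : seq {set 'I_n}) : Prop :=
  perm_eq s (enum sccs) /\
  forall S T, S \in s -> T \in s -> scc_edge S T -> (index T s < index S s)%N.

Definition set_block S (x : 'cV[R]_#|S|) y : 'cV[R]_n :=
  \col_i if scc_index S i is Some k then x k 0 else y i 0.

Definition rdnm_scc q (h g : nat) y S : option 'cV[R]_n :=
  omap (fun x => set_block x y)
    (rnm h (subsystem S y) (if linear_scc q S then 1 else g)).

(* [q] is the LFP of [P]: it only serves to tell linear and nonlinear SCCs
   apart.  The initial vector is irrelevant when [s] is bottom-up, since every
   coordinate is set before it is read. *)
Definition rdnm q (h g : nat) (s : seq {set 'I_n}) : option 'cV[R]_n :=
  foldl (fun oy S => obind (fun y => rdnm_scc q h g y S) oy) (Some 0) s.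

End Decomposition.

Section Bounds.

Variable R : realType.

(* The default [head 0 s] belongs to [s] unless [s] is empty. *)
Definition seq_min (s : seq R) : R := \big[Num.min/head 0 s]_(x <- s) x.

Definition log2 (x : R) : R := exp.ln x / exp.ln 2.

Variables (n : nat) (P : system R n) (q : 'cV[R]_n).

Definition qmin : R := seq_min [seq q i 0 | i <- enum 'I_n].

Definition cmin : R :=
  seq_min [seq (P i)@_m | i <- enum 'I_n, m <- msupp (P i)].

Definition alpha : R := Num.min 1 cmin * (2^-1 * qmin).

End Bounds.

Section Facts.

Lemma round_down_spec (R : realType) (h : nat) (x : R) :
  round_down h x <= Num.max x 0 /\
  forall k : nat, k%:R / 2 ^+ h <= Num.max x 0 -> k%:R / 2 ^+ h <= round_down h x.
Proof.
have p2 : 0 < 2 ^+ h :> R by rewrite exprn_gt0.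
have m0 : 0 <= 2 ^+ h * Num.max x 0 by apply: mulr_ge0; [exact: ltW | rewrite le_max lexx orbT].
split; first by rewrite ler_pdivrMr// [leRHS]mulrC truncn_le.
move=> k; rewrite ler_pdivrMr// [leRHS]mulrC => hk.
by rewrite ler_pM2r ?invr_gt0// ler_nat truncn_ge_nat.
Qed.

Variables (R : realType) (n : nat) (P : system R n).

Let reach (S : {set 'I_n}) := [set j | [exists i in S, connect (dep_edge P) i j]].

Let reach_scc i : reach (scc_of P i) = [set j | connect (dep_edge P) i j].
Proof.
apply/setP => j; rewrite !inE; apply/existsP/idP.
  by case=> k /andP[]; rewrite inE => /andP[ik _]; apply: connect_trans.
by move=> ij; exists i; rewrite inE !connect0.
Qed.

Let reach_edge S T : S \in sccs P -> T \in sccs P -> scc_edge P S T ->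
  (#|reach T| < #|reach S|)%N.
Proof.
move=> /imsetP[i _ ->] /imsetP[j _ ->] /andP[ne].
case/existsP=> k /andP[]; rewrite inE => /andP[ik ki].
case/existsP=> l /andP[]; rewrite inE => /andP[jl lj] kl.
have ij : connect (dep_edge P) i j.
  exact: connect_trans ik (connect_trans (connect1 kl) lj).
rewrite !reach_scc; apply: proper_card; apply/properP; split.
  by apply/subsetP => x; rewrite !inE; apply: connect_trans.
exists i; rewrite inE ?connect0//; apply/negP => ji; case/negP: ne; apply/eqP.
apply/setP => x; rewrite !inE; apply/andP/andP => -[a b]; split.
- exact: connect_trans ji a.
- exact: connect_trans b ij.
- exact: connect_trans ij a.
- exact: connect_trans b ji.
Qed.

Lemma size_scc_path s : scc_path P s -> (size s <= n)%N.
Proof.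
move=> /andP[sP ss].
have: sorted (fun S T => #|reach T| < #|reach S|)%N s.
  apply: (sub_in_sorted (P := mem (sccs P))) sP ss => S T.
  exact: reach_edge.
have tr : transitive (fun S T : {set 'I_n} => #|reach T| < #|reach S|)%N.
  by move=> A B C /[swap]; apply: ltn_trans.
move=> /(sorted_uniq tr (fun S => ltnn _)) us.
have: (#|sccs P| <= n)%N by rewrite (leq_trans (leq_imset_card _ _))// card_ord.
apply: leq_trans; rewrite -(card_uniqP us).
by apply/subset_leq_card/subsetP => S /(allP sP).
Qed.

Lemma exists_bottom_up : exists s, bottom_up P s.
Proof.
pose r (S T : {set 'I_n}) := (#|reach S| <= #|reach T|)%N.
exists (sort r (enum (sccs P))); split; first by rewrite perm_sort.
move=> S T; rewrite !mem_sort !mem_enum => hS hT e.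
rewrite ltnNge; apply/negP => le.
have := reach_edge hS hT e; rewrite ltnNge => /negP; apply.
have tr : transitive r by move=> A B C; apply: leq_trans.
have so : sorted r (sort r (enum (sccs P))) by apply: sort_sorted => A B; apply: leq_total.
have := @sorted_leq_nth _ r tr (fun _ => leqnn _) set0 _ so
  (index S (sort r (enum (sccs P)))) (index T (sort r (enum (sccs P)))).
rewrite !inE !index_mem !mem_sort !mem_enum hS hT => /(_ isT isT le).
by rewrite !nth_index ?mem_sort ?mem_enum.
Qed.

End Facts.

(* Main.v *)
Require Import Defs.
From mathcomp Require Import all_boot all_order all_algebra.
From mathcomp Require Import mpoly reals.
From mathcomp Require Import ring lra zify.
From mathcomp Require exp matrix_normedtype.

(** All polynomials are quadratic, so second-order Taylor expansion is exact.

    Fix an SCC [S], write [Q] for its system at the values [y <= q] already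
    computed, and [J] for the Jacobian.  The Kleene iterates of [P] increase to
    [q]; since [q - P(x) >= J(x) (q - x)], a cluster point of the normalised
    errors on [S] is a vector [v] with [J(q) v <= v], and strong connectivity
    makes it positive with entries of ratio at most [alpha^-(#|S|-1)].

    Nonlinear [S].  A fixed point [p <= q] of [Q] has error [x = q - p] with
    [x = J(q) x - H(x, x) + eta].  At an index maximising [x_i / v_i] the vector
    [t v - x] vanishes; following edges to a nonlinear row bounds [H(x, x)]
    there, hence bounds a product of two entries of [x], and [x] is comparable
    to each of its entries.  So [x] is of order [sqrt eta]: this is the source
    of the factor [2^f].  Newton's method started below [p] stays below [p] and
    halves the least [t] with [p - z <= t v], up to the rounding error.

    Linear [S].  Here [q] itself plays the role of [v] and one Newton step is
    exact; the loss is a constant factor.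

    With [K] the quantity whose logarithm appears in the bound on [h] and
    [beta = eps K^-d], the error on [S] is at most [K^d' beta^(2^(f-f'))], where
    [d'] and [f'] are the depths of the paths starting at [S]. *)

Set Implicit Arguments.
Unset Strict Implicit.
Unset Printing Implicit Defensive.

Import Order.TTheory GRing.Theory Num.Theory.
Local Open Scope ring_scope.

(** * Coefficients, derivatives and exact Taylor expansion in degree two *)

Section QuadraticPolynomials.

Variables (R : realType) (n : nat).
Implicit Types (f : {mpoly R[n]}) (x y z : 'I_n -> R).

(* Half of the second partial derivative. *)
Definition quad_coef f (j k : 'I_n) : R :=
  f@_(U_(j) + U_(k)) / (1 + (j != k)%:R).

Lemma quad_coefC f j k : quad_coef f j k = quad_coef f k j.
Proof. by rewrite /quad_coef eq_sym addmC. Qed.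

Lemma mnm1D_eq (a b j k : 'I_n) :
  ((U_(j) + U_(k))%MM == (U_(a) + U_(b))%MM) =
  ((j == a) && (k == b)) || ((j == b) && (k == a)).
Proof.
apply/eqP/orP => [E|[/andP[/eqP-> /eqP->]//|/andP[/eqP-> /eqP->]]]; last exact: addmC.
(* Comparing exponents at the four indices involved reduces the claim to finitely many boolean
   cases. *)
have E' i : ((j == i) + (k == i) = (a == i) + (b == i))%N.
  by have := congr1 (fun m : 'X_{1..n} => m i) E; rewrite !mnmDE !mnm1E.
have := E' a; have := E' b; have := E' j; have := E' k.
rewrite !eqxx ![a == _]eq_sym ![b == _]eq_sym [k == j]eq_sym.
by case: (j == a); case: (k == b); case: (j == b); case: (k == a);
  case: (j == k); case: (a == b) => //; auto.
Qed.

Lemma mdeg2P (m : 'X_{1..n}) : mdeg m = 2%N ->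
  exists a b, m = (U_(a) + U_(b))%MM.
Proof.
move=> m2; have [i mi] : exists i, (0 < m i)%N.
  apply/existsP; apply: contraTT isT; rewrite negb_exists => /forallP m0.
  move: m2; rewrite mdegE big1// => i _; have := m0 i; lia.
have E : m = (m - U_(i) + U_(i))%MM.
  rewrite submK//; apply/mnm_lepP => l; rewrite mnm1E.
  by case: eqP => [<-|//]; rewrite mi.
have /eqP/mdeg1P[a /eqP ea] : mdeg (m - U_(i)) = 1%N.
  have : mdeg (m - U_(i) + U_(i)) = 2%N by rewrite -E.
  by rewrite mdegD mdeg1; lia.
by exists a, i; rewrite {1}E ea.
Qed.

(** Coefficients are compared degree by degree. An off-diagonal monomial is met twice in the double
    sum, which the weight in [quad_coef] compensates. *)
Lemma quadratic_mpolyE f : (msize f <= 3)%N ->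
  f = (f@_0)%:MP + \sum_j f@_U_(j) *: 'X_j
      + \sum_j \sum_k quad_coef f j k *: ('X_j * 'X_k).
Proof.
move=> sf; apply/mpolyP => m; rewrite !mcoeffD mcoeffC.
have -> : (\sum_j f@_U_(j) *: 'X_j)@_m = \sum_j f@_U_(j) * (U_(j)%MM == m)%:R.
  by rewrite raddf_sum/=; apply: eq_bigr => j _; rewrite mcoeffZ mcoeffX.
have -> : (\sum_j \sum_k quad_coef f j k *: ('X_j * 'X_k : {mpoly R[n]}))@_m =
    \sum_j \sum_k quad_coef f j k * ((U_(j) + U_(k))%MM == m)%:R.
  rewrite raddf_sum/=; apply: eq_bigr => j _; rewrite raddf_sum/=.
  by apply: eq_bigr => k _; rewrite mcoeffZ -mpolyXD mcoeffX.
case dm : (mdeg m) => [|[|[|d]]].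
- have -> : m = 0%MM by apply/eqP; rewrite -mdeg_eq0 dm.
  rewrite eqxx mulr1 [X in _ + X + _]big1 ?[X in _ + X]big1 ?addr0//.
    move=> j _; rewrite big1// => k _.
    by rewrite -mdeg_eq0 mdegD !mdeg1 mulr0.
  by move=> j _; rewrite mnm1_eq0 mulr0.
- have /mdeg1P[i /eqP ->] : mdeg m == 1%N by rewrite dm.
  rewrite mnm1_eq0 mulr0 add0r [X in _ + X]big1 ?addr0; last first.
    move=> j _; rewrite big1// => k _; case: eqP => [/(congr1 mdeg)|].
      by rewrite mdegD !mdeg1.
    by rewrite mulr0.
  rewrite (bigD1 i)//= eqxx mulr1 big1 ?addr0// => j ji.
  by rewrite eq_mnm1 (negbTE ji) mulr0.
- have [a [b ->]] := mdeg2P dm.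
  rewrite -mdeg_eq0 mdegD !mdeg1 mulr0 add0r [X in X + _]big1 ?add0r; last first.
    move=> j _; case: eqP => [/(congr1 mdeg)|]; last by rewrite mulr0.
    by rewrite mdegD !mdeg1.
  have [<-|ab] := eqVneq a b.
    rewrite (bigD1 a)//= (bigD1 a)//= eqxx mulr1.
    rewrite big1 ?addr0; last first.
      move=> k ka; rewrite mnm1D_eq eqxx/= (negbTE ka) /= mulr0//.
    rewrite big1 ?addr0; first by rewrite /quad_coef eqxx/= addr0 divr1.
    move=> j ja; rewrite big1// => k _.
    by rewrite mnm1D_eq (negbTE ja)/= mulr0.
  pose G j := \sum_k quad_coef f j k * ((U_(j) + U_(k))%MM == (U_(a) + U_(b))%MM)%:R.
  rewrite -[RHS]/(\sum_j G j) (bigD1 a)// (bigD1 b) 1?eq_sym//=.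
  rewrite [X in _ + (_ + X)]big1 ?addr0; last first.
    move=> j /andP[ja jb]; rewrite /G big1// => k _.
    by rewrite mnm1D_eq (negbTE ja) (negbTE jb)/= mulr0.
  rewrite /G (bigD1 b)//= eqxx mulr1 big1 ?addr0; last first.
    by move=> k kb; rewrite mnm1D_eq eqxx (negbTE kb) (negbTE ab)/= mulr0.
  rewrite (bigD1 a)//= mnm1D_eq !eqxx orbT mulr1 big1 ?addr0; last first.
    by move=> k ka; rewrite mnm1D_eq eqxx (negbTE ka) [b == a]eq_sym (negbTE ab)/= mulr0.
  rewrite [quad_coef f b a]quad_coefC /quad_coef ab/=.
  by field.
- have -> : f@_m = 0 by apply/eqP; rewrite mcoeff_eq0; apply: msize_mdeg_ge; rewrite dm (leq_trans sf).
  rewrite -mdeg_eq0 dm mulr0 !big1 ?addr0//.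
    move=> j _; rewrite big1// => k _; case: eqP => [/(congr1 mdeg)|]; last by rewrite mulr0.
    by rewrite mdegD !mdeg1 dm.
  move=> j _; case: eqP => [/(congr1 mdeg)|]; last by rewrite mulr0.
  by rewrite mdeg1 dm.
Qed.

Lemma mderivXU (i j : 'I_n) : ('X_j : {mpoly R[n]})^`M(i) = (i == j)%:R%:MP.
Proof.
rewrite mderivX mnm1E eq_sym; have [->|_] := eqVneq; last by rewrite scale0r mpolyC0.
by rewrite scale1r -[X in (X - _)%MM]add0m addmK mpolyX0 mpolyC1.
Qed.

(** The symmetric bilinear form H of the overview, polarising the part of degree two. *)
Definition quad_part f x y := \sum_j \sum_k quad_coef f j k * (x j * y k).

Lemma meval_quadratic f x : (msize f <= 3)%N ->
  f.@[x] = f@_0 + \sum_j f@_U_(j) * x j + quad_part f x x.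
Proof.
move=> sf; rewrite {1}(quadratic_mpolyE sf) !mevalD mevalC; congr (_ + _ + _).
  by rewrite raddf_sum/=; apply: eq_bigr => j _; rewrite mevalZ mevalXU.
rewrite raddf_sum/=; apply: eq_bigr => j _; rewrite raddf_sum/=.
by apply: eq_bigr => k _; rewrite mevalZ mevalM !mevalXU.
Qed.

(** The product rule yields one sum for each factor of ['X_j * 'X_k]; symmetry of [quad_coef]
    identifies the two, hence the factor 2. *)
Lemma mderiv_quadratic f x i : (msize f <= 3)%N ->
  f^`M(i).@[x] = f@_U_(i) + 2 * \sum_k quad_coef f i k * x k.
Proof.
move=> sf; rewrite {1}(quadratic_mpolyE sf) !mderivD mderivC add0r mevalD; congr (_ + _).
  rewrite (raddf_sum (mderiv i)) (raddf_sum (meval x))/= (bigD1 i)//= big1 ?addr0.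
    by rewrite mderivZ mderivXU mevalZ eqxx mevalC mulr1.
  by move=> j ji; rewrite mderivZ mderivXU mevalZ eq_sym (negbTE ji) mevalC mulr0.
have E j k : ((quad_coef f j k *: ('X_j * 'X_k))^`M(i)).@[x] =
    quad_coef f j k * ((i == j)%:R * x k) + quad_coef f j k * ((i == k)%:R * x j).
  rewrite mderivZ mderivM !mderivXU mevalZ mevalD !mevalM !mevalC !mevalXU.
  by rewrite mulrDr [x j * _]mulrC.
rewrite (raddf_sum (mderiv i)) (raddf_sum (meval x))/=.
transitivity (\sum_j \sum_k (quad_coef f j k * ((i == j)%:R * x k)
    + quad_coef f j k * ((i == k)%:R * x j))).
  apply: eq_bigr => j _; rewrite (raddf_sum (mderiv i)) (raddf_sum (meval x))/=.
  by apply: eq_bigr => k _; rewrite E.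
rewrite (eq_bigr (fun j => \sum_k quad_coef f j k * ((i == j)%:R * x k) +
  \sum_k quad_coef f j k * ((i == k)%:R * x j))); last by move=> j _; rewrite big_split.
rewrite big_split/= (bigD1 i)//= [X in _ + X + _]big1 ?addr0; last first.
  by move=> j ji; rewrite big1// => k _; rewrite eq_sym (negbTE ji) mul0r mulr0.
rewrite exchange_big/= [X in _ + X](bigD1 i)//= [X in _ + (_ + X)]big1 ?addr0; last first.
  by move=> j ji; rewrite big1// => k _; rewrite eq_sym (negbTE ji) mul0r mulr0.
rewrite mulrDl !mul1r; congr (_ + _); apply: eq_bigr => k _; rewrite eqxx mul1r//.
by rewrite quad_coefC.
Qed.

Lemma quad_part_linear f x y :
  \sum_j (\sum_k quad_coef f j k * x k) * y j = quad_part f x y.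
Proof.
under eq_bigr do rewrite mulr_suml.
rewrite exchange_big/=; apply: eq_bigr => j _.
by apply: eq_bigr => k _; rewrite quad_coefC mulrA.
Qed.

Lemma quad_partB f x z : quad_part f (fun j => x j - z j) (fun j => x j - z j) =
  quad_part f x x - 2 * quad_part f z x + quad_part f z z.
Proof.
have C : quad_part f z x = quad_part f x z.
  rewrite /quad_part exchange_big/=; apply: eq_bigr => j _; apply: eq_bigr => k _.
  by rewrite quad_coefC [z _ * _]mulrC.
have -> : 2 * quad_part f z x = quad_part f z x + quad_part f x z by rewrite -C mulrDl !mul1r.
rewrite /quad_part -big_split/= -sumrB -big_split/=; apply: eq_bigr => j _.
rewrite -big_split/= -sumrB -big_split/=; apply: eq_bigr => k _; ring.
Qed.

Lemma taylor_quadratic f x z : (msize f <= 3)%N ->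
  f.@[x] = f.@[z] + \sum_j f^`M(j).@[z] * (x j - z j)
    + quad_part f (fun j => x j - z j) (fun j => x j - z j).
Proof.
move=> sf; rewrite !meval_quadratic// quad_partB.
have -> : \sum_j f^`M(j).@[z] * (x j - z j) = \sum_j f@_U_(j) * x j
    - \sum_j f@_U_(j) * z j + 2 * (quad_part f z x - quad_part f z z).
  rewrite -!quad_part_linear -sumrB -sumrB mulr_sumr -big_split/=.
  by apply: eq_bigr => j _; rewrite mderiv_quadratic//; ring.
by ring.
Qed.

Lemma mderiv_quadraticB f x z i : (msize f <= 3)%N ->
  f^`M(i).@[x] - f^`M(i).@[z] = 2 * \sum_k quad_coef f i k * (x k - z k).
Proof.
move=> sf; rewrite !mderiv_quadratic// opprD addrACA subrr add0r -mulrBr -sumrB.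
by congr (_ * _); apply: eq_bigr => k _; rewrite mulrBr.
Qed.

End QuadraticPolynomials.

(** * Cluster points in the unit cube *)

Section Compactness.

Import normed_module.numFieldNormedType.Exports.

(** Compactness of the cube, applied to the image of the filter of eventual indices. Stating that
    the sequence returns near [w] beyond every [M] avoids extracting a subsequence. *)
Lemma bounded_seq_cluster (R : realType) m (v : nat -> 'I_m -> R) :
  (forall k i, 0 <= v k i <= 1) ->
  exists w : 'I_m -> R, forall e : R, 0 < e -> forall M : nat,
    exists2 k : nat, (M <= k)%N & forall i, `|v k i - w i| < e.
Proof.
move=> v01.
have C := @matrix_normedtype.rV_compact _ m (fun=> classical_sets.mkset (fun x : R => x \in `[0, 1]))
  (fun i => @normed_module.segment_compact R 0 1).
pose u k : 'rV[R]_m := \row_i v k i.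
pose F := filter.fmap u filter.eventually.
have PF : filter.ProperFilter F.
  apply: filter.fmap_proper_filter; apply: filter.eventually_filter.
have [|w [_ wF]] := C F PF _ .
- by exists 0%N => // k _ i /=; rewrite mxE in_itv /= v01.
exists (w 0) => e e0 M.
have FM : F (fun x => exists2 k, (M <= k)%N & x = u k).
  by exists M => // k /= Mk; exists k.
have [|x [[k Mk ->] xw]] := wF _ (fun x : 'rV[R]_m => forall i, `|x 0 i - w 0 i| < e) FM.
  exists (fun i j (y : R) => `|y - w i j| < e) => [i j|x wx i]; last exact: wx.
  apply/pseudometric_structure.nbhs_ballP; exists e => //= y.
  by rewrite /pseudometric_structure.ball/= distrC.
by exists k => // i; have := xw i; rewrite mxE.
Qed.

End Compactness.

(** * Order estimates for polynomials with nonnegative coefficients *)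

Section MonotonePolynomials.

Variables (R : realType) (n : nat) (f : {mpoly R[n]}).
Hypotheses (f_ge0 : forall m, 0 <= f@_m) (f_quad : (msize f <= 3)%N).
Implicit Types (x y z : 'I_n -> R).

Lemma quad_coef_ge0 j k : 0 <= quad_coef f j k.
Proof. by rewrite /quad_coef divr_ge0// addr_ge0. Qed.

Lemma quad_part_ge0 x y : (forall j, 0 <= x j) -> (forall j, 0 <= y j) ->
  0 <= quad_part f x y.
Proof.
move=> x0 y0; apply: sumr_ge0 => j _; apply: sumr_ge0 => k _.
by rewrite mulr_ge0 ?quad_coef_ge0 ?mulr_ge0.
Qed.

Lemma quad_part_ge x y j k : (forall j, 0 <= x j) -> (forall j, 0 <= y j) ->
  quad_coef f j k * (x j * y k) <= quad_part f x y.
Proof.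
move=> x0 y0; have t i l : 0 <= quad_coef f i l * (x i * y l).
  by rewrite mulr_ge0 ?quad_coef_ge0 ?mulr_ge0.
rewrite /quad_part (bigD1 j)//= (bigD1 k)//= -addrA lerDl addr_ge0 ?sumr_ge0//.
by move=> i _; rewrite sumr_ge0.
Qed.

Lemma quad_part_eq0 x y : (forall j, 0 < x j) -> (forall j, 0 < y j) ->
  quad_part f x y <= 0 -> forall j k, quad_coef f j k = 0.
Proof.
move=> x0 y0 le0 j k; apply/eqP; rewrite eq_le quad_coef_ge0 andbT.
have := le_trans (quad_part_ge j k (fun j => ltW (x0 j)) (fun j => ltW (y0 j))) le0.
by rewrite pmulr_lle0// mulr_gt0.
Qed.

Lemma mderiv_quad_part x z v :
  \sum_j (f^`M(j).@[x] - f^`M(j).@[z]) * v j = 2 * quad_part f (fun j => x j - z j) v.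
Proof.
rewrite -quad_part_linear mulr_sumr; apply: eq_bigr => j _.
by rewrite mderiv_quadraticB// mulrA.
Qed.

Lemma mderiv_ge0 x i : (forall j, 0 <= x j) -> 0 <= f^`M(i).@[x].
Proof.
move=> x0; rewrite mderiv_quadratic// addr_ge0// mulr_ge0// sumr_ge0// => k _.
by rewrite mulr_ge0 ?quad_coef_ge0.
Qed.

Lemma mderiv_le x z i : (forall j, z j <= x j) -> f^`M(i).@[z] <= f^`M(i).@[x].
Proof.
move=> zx; rewrite -subr_ge0 mderiv_quadraticB// mulr_ge0// sumr_ge0// => k _.
by rewrite mulr_ge0 ?quad_coef_ge0// subr_ge0.
Qed.

Lemma meval_ge_tangent x z : (forall j, z j <= x j) ->
  f.@[z] + \sum_j f^`M(j).@[z] * (x j - z j) <= f.@[x].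
Proof.
move=> zx; rewrite (taylor_quadratic x z)// lerDl.
by apply: quad_part_ge0 => j; rewrite subr_ge0.
Qed.

(** The gradient of a quadratic is affine, so its mean over a segment is its value at the midpoint:
    a mean value theorem with an explicit point. *)
Lemma meval_midpoint x z :
  f.@[x] - f.@[z] = \sum_j f^`M(j).@[fun k => (x k + z k) / 2] * (x j - z j).
Proof.
rewrite (taylor_quadratic x z)//.
have -> : \sum_j f^`M(j).@[fun k => (x k + z k) / 2] * (x j - z j) =
    \sum_j f^`M(j).@[z] * (x j - z j)
    + quad_part f (fun j => x j - z j) (fun j => x j - z j).
  rewrite -quad_part_linear -big_split/=; apply: eq_bigr => j _.
  rewrite -mulrDl; congr (_ * _).
  rewrite -[LHS](subrK f^`M(j).@[z]) mderiv_quadraticB// addrC; congr (_ + _).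
  by rewrite mulr_sumr; apply: eq_bigr => k _; field.
by ring.
Qed.

Lemma meval_le x z : (forall j, 0 <= z j) -> (forall j, z j <= x j) ->
  f.@[z] <= f.@[x].
Proof.
move=> z0 zx; apply: le_trans (meval_ge_tangent zx); rewrite lerDl sumr_ge0// => j _.
by rewrite mulr_ge0 ?mderiv_ge0 ?subr_ge0.
Qed.

Lemma meval_le_tangent x z : (forall j, z j <= x j) ->
  f.@[x] <= f.@[z] + \sum_j f^`M(j).@[x] * (x j - z j).
Proof.
move=> zx; rewrite -lerBlDl meval_midpoint; apply: ler_sum => j _.
rewrite ler_wpM2r ?subr_ge0//; apply: mderiv_le => k.
by have := zx k; lra.
Qed.

Lemma meval_ge0 x : (forall j, 0 <= x j) -> 0 <= f.@[x].
Proof.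
move=> x0; apply: (@le_trans _ _ f.@[fun=> 0]); last exact: meval_le.
rewrite meval_quadratic// !addr_ge0// ?quad_part_ge0//.
by apply: sumr_ge0 => j _; rewrite mulr0.
Qed.

End MonotonePolynomials.

(** * Kleene iteration and its limit *)

Section Kleene.

Variables (R : realType) (n : nat) (Q : system R n).
Hypotheses (Q_MPS : is_MPS Q) (Q_quad : quadratic Q).
Implicit Types (x y z : 'I_n -> R).

Definition kleene k : 'I_n -> R := iter k (fun x i => (Q i).@[x]) (fun=> 0).

Lemma kleene_ge0 k i : 0 <= kleene k i.
Proof. by elim: k i => //= k IH i; apply: meval_ge0. Qed.

Lemma kleene_nondecreasing k l i : (k <= l)%N -> kleene k i <= kleene l i.
Proof.
move=> kl; rewrite -(subnKC kl) addnC; elim: k (l - k)%N i {kl} => [|k IH] d i.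
  exact: kleene_ge0.
rewrite addnS; apply: (meval_le (Q_MPS i) (Q_quad i)) => j; last exact: IH.
exact: kleene_ge0.
Qed.

Lemma kleene_le q k i : (forall j, 0 <= q j) -> (forall j, (Q j).@[q] <= q j) ->
  kleene k i <= q i.
Proof.
move=> q0 Qq; elim: k i => //= k IH i; apply: le_trans (Qq i).
by apply: meval_le => //; exact: kleene_ge0.
Qed.

(** The limit is the coordinatewise supremum. A [q] with [Q(q) <= q] is enough as an upper bound,
    which also covers a subsystem into which values below the true ones are inserted. *)
Lemma kleene_limit q : (forall j, 0 <= q j) -> (forall j, (Q j).@[q] <= q j) ->
  exists p : 'I_n -> R,
    [/\ forall i, 0 <= p i <= q i, forall i, (Q i).@[p] = p i,
        forall k i, kleene k i <= p i
      & forall e, 0 < e -> exists M : nat, forall k i, (M <= k)%N -> p i - kleene k i <= e].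
Proof.
move=> q0 Qq; pose E i : classical_sets.set R := fun r => exists k, r = kleene k i.
have hE i : classical_sets.has_sup (E i).
  split; first by exists (kleene 0 i), 0%N.
  by exists (q i) => _ [k ->]; apply: kleene_le.
pose p i := sup (E i).
have kp k i : kleene k i <= p i by apply: sup_upper_bound => //; exists k.
have p0 i : 0 <= p i := le_trans (kleene_ge0 0 i) (kp 0%N i).
have pq i : p i <= q i by apply: ge_sup => [|_ [k ->]]; [case: (hE i)|apply: kleene_le].
have cv e : 0 < e -> exists M : nat, forall k i, (M <= k)%N -> p i - kleene k i <= e.
  move=> e0; have F i : exists k, p i - kleene k i <= e.
    have [_ [k ->] ek] := sup_adherent e0 (hE i).
    by exists k; rewrite lerBlDr -lerBlDl ltW.
  have [M HM] : exists M : 'I_n -> nat, forall i, p i - kleene (M i) i <= e.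
    by exists (fun i => xchoose (F i)) => i; apply: (xchooseP (F i)).
  exists (\max_i M i)%N => k i le_k; apply: le_trans (HM i); rewrite lerD2l lerN2.
  by apply: kleene_nondecreasing; apply: leq_trans le_k; apply: leq_bigmax.
exists p; split => // [i|i]; first by rewrite p0 pq.
apply/eqP; rewrite eq_le; apply/andP; split.
  apply/ler_addgt0Pr => e e0.
  (* By the tangent bound at [p], errors of size [e / (C + 1)] in the iterate change the value by at
     most [e]. *)
  pose C := \sum_j (Q i)^`M(j).@[p].
  have C0 : 0 <= C by apply: sumr_ge0 => j _; apply: mderiv_ge0.
  have [M HM] := cv (e / (C + 1)) (divr_gt0 e0 (ltr_wpDl C0 ltr01)).
  apply: le_trans (meval_le_tangent _ _ (z := kleene M) _) _ => //.
  apply: lerD; first exact: (kp M.+1).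
  apply: (@le_trans _ _ (C * (e / (C + 1)))).
    by rewrite mulr_suml; apply: ler_sum => j _; rewrite ler_wpM2l ?mderiv_ge0 ?HM.
  by rewrite mulrCA ger_pMr// ler_pdivrMr ?mul1r ?lerDl// ltr_wpDl.
apply: ge_sup => [|_ [k ->]]; first by case: (hE i).
apply: le_trans (kleene_nondecreasing i (leqnSn k)) _ => /=.
by apply: meval_le => // j; exact: kleene_ge0.
Qed.

End Kleene.

(** * Inverse positivity from a positive supersolution *)

Section NonnegativeMatrices.

Variables (R : realType) (m : nat).
Implicit Types (A : 'I_m -> 'I_m -> R) (u v x : 'I_m -> R).

(* Where [u i / v i] attains a negative minimum, [A v = v] and the minimum
   propagates along the nonzero entries of the row. *)
Lemma mmatrix_ge0 A v u :
  (forall i j, 0 <= A i j) -> (forall i, 0 < v i) ->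
  (forall i, \sum_j A i j * v j <= v i) ->
  (forall Z : pred 'I_m,
    (forall i, Z i -> \sum_j A i j * v j = v i /\ forall j, 0 < A i j -> Z j) ->
    forall i, ~~ Z i) ->
  (forall i, \sum_j A i j * u j <= u i) -> forall i, 0 <= u i.
Proof.
move=> A0 v0 Av noZ Au i0; rewrite leNgt; apply/negP => u0.
case: (@Order.TotalTheory.arg_minP _ _ _ i0 xpredT (fun i => u i / v i)) => // k _ kmin.
set t := u k / v k in kmin.
have t0 : t < 0.
  by apply: le_lt_trans (kmin i0 isT) _; rewrite ltr_pdivrMr// mul0r.
have tu j : t * v j <= u j by rewrite -ler_pdivlMr// kmin.
suff : ~~ (u k == t * v k) by rewrite /t divfK ?eqxx// gt_eqF.
apply: (noZ (fun i => u i == t * v i)) => i /eqP ui.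
have S0 : 0 <= \sum_j A i j * (u j - t * v j).
  by apply: sumr_ge0 => j _; rewrite mulr_ge0 ?subr_ge0.
have SE : \sum_j A i j * (u j - t * v j) = \sum_j A i j * u j - t * \sum_j A i j * v j.
  rewrite mulr_sumr -sumrB; apply: eq_bigr => j _; ring.
have tv : t * v i <= t * \sum_j A i j * v j by rewrite ler_nM2l.
have Aui := Au i.
have /eqP E0 : \sum_j A i j * (u j - t * v j) == 0 by rewrite eq_le S0 andbT SE; lra.
split.
  by apply/eqP; rewrite eq_le Av/= -(ler_nM2l t0); lra.
move=> j Aij.
have H : forall l, xpredT l -> 0 <= A i l * (u l - t * v l).
  by move=> l _; rewrite mulr_ge0 ?subr_ge0.
have /eqP := psumr_eq0P H E0 (i := j) isT.
by rewrite mulf_eq0 gt_eqF//= subr_eq0.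
Qed.

End NonnegativeMatrices.

(** * Invertibility of [1 - A] *)

Section MatrixInverse.

Variables (R : realType) (m : nat).

Lemma unitmx_ker (M : 'M[R]_m) :
  (forall w : 'cV[R]_m, M *m w = 0 -> w = 0) -> M \in unitmx.
Proof.
move=> kerM; rewrite -unitmx_tr -row_free_unit; apply: inj_row_free => v vM.
apply: trmx_inj; rewrite trmx0; apply: kerM.
by apply: trmx_inj; rewrite trmx_mul trmxK vM trmx0.
Qed.

(** A kernel vector [w] satisfies [A w = w], so the positivity principle applies to both [w] and
    [- w]. *)
Lemma unitmx_1B (A : 'M[R]_m) :
  (forall u : 'I_m -> R, (forall i, \sum_j A i j * u j <= u i) -> forall i, 0 <= u i) ->
  1%:M - A \in unitmx.
Proof.
move=> pos; apply: unitmx_ker => w; rewrite mulmxBl mul1mx => /eqP; rewrite subr_eq0 => /eqP wE.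
have E i : w i 0 = \sum_j A i j * w j 0 by rewrite {1}wE mxE.
have w0 := pos (fun i => w i 0); have w1 := pos (fun i => - w i 0).
apply/colP => i; rewrite mxE; apply/eqP; rewrite eq_le; apply/andP; split.
  rewrite -oppr_ge0; apply: w1 => k; rewrite [w k 0]E -sumrN.
  by apply: ler_sum => j _; rewrite mulrN.
by apply: w0 => k; rewrite -E.
Qed.

Lemma invmx_1BE (A : 'M[R]_m) (r : 'cV[R]_m) i : 1%:M - A \in unitmx ->
  (invmx (1%:M - A) *m r) i 0 =
  \sum_j A i j * (invmx (1%:M - A) *m r) j 0 + r i 0.
Proof.
move=> U; set w := invmx _ *m r.
have : (1%:M - A) *m w = r by rewrite /w mulmxA mulmxV// mul1mx.
rewrite mulmxBl mul1mx => /(congr1 (fun M : 'cV[R]_m => M i 0)); rewrite !mxE => <-.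
by rewrite [RHS]addrC subrK.
Qed.

End MatrixInverse.

(** * Irreducible nonnegative matrices *)

Section Irreducible.

Variables (R : realType) (m : nat) (e : rel 'I_m).
Hypothesis e_conn : forall i j, connect e i j.

(** Induction along a path without repeated vertices. Such a path has at most [m - 1] edges, the
    source of the exponents [m.-1] below. *)
Lemma connect_ind_size (T : nat -> 'I_m -> Prop) i :
  T 0%N i -> (forall k j l, e j l -> T k j -> T k.+1 l) ->
  forall j, exists2 k, (k < m)%N & T k j.
Proof.
move=> T0 TS j; have /connectP[p0 pe ->] := e_conn i j.
case/shortenP: pe => p pe up _.
exists (size p); first by have := max_card (mem (i :: p)); rewrite (card_uniqP up) card_ord.
elim/last_ind: p pe {up} => //= p x IH; rewrite rcons_path last_rcons size_rcons => /andP[pp px].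
exact: TS px (IH pp).
Qed.

Lemma closed_full (Z : pred 'I_m) i : Z i -> (forall j l, e j l -> Z j -> Z l) ->
  forall j, Z j.
Proof. by move=> Zi ZS j; have [] := connect_ind_size (T := fun=> Z) Zi (fun _ => ZS) j. Qed.

Variable b : R.
Hypothesis b_ge2 : 2 <= b.

Variable A : 'I_m -> 'I_m -> R.
Hypotheses (A_ge0 : forall i j, 0 <= A i j)
  (A_edge : forall i j, e i j -> 1 <= b * A i j).

(** Row [l] gives [A l l' * x l' <= x l], so each edge costs at most a factor [b]. *)
Lemma supersolution_spread (x : 'I_m -> R) :
  (forall i, 0 <= x i) -> (forall i, \sum_j A i j * x j <= x i) ->
  forall i j, x j <= b ^+ m.-1 * x i.
Proof.
move=> x0 Ax i j.
have [|k l l' ll' xl|k km xj] :=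
  @connect_ind_size (fun k l => x l <= b ^+ k * x i) i _ _ j.
- by rewrite expr0 mul1r.
- have t : A l l' * x l' <= x l.
    apply: le_trans (Ax l); rewrite (bigD1 l')//= lerDl sumr_ge0// => k' _.
    by rewrite mulr_ge0.
  apply: (@le_trans _ _ (b * A l l' * x l')); first by rewrite ler_peMl ?A_edge.
  by rewrite exprS -!mulrA ler_wpM2l ?(le_trans _ b_ge2)// (le_trans t).
apply: le_trans xj _; rewrite ler_wpM2r// ler_weXn2l//; last by lia.
by apply: le_trans b_ge2; rewrite ler1n.
Qed.

(* The deficit [D] vanishes at one index; row [i] bounds it at the successors of [i]. *)
Lemma deficit_bound (D r : 'I_m -> R) (eta : R) i0 :
  0 <= eta -> (forall i, 0 <= D i) -> (forall i, 0 <= r i) -> D i0 = 0 ->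
  (forall i, \sum_j A i j * D j + r i <= eta + D i) ->
  forall i, r i <= 2 * b ^+ m.-1 * eta.
Proof.
move=> eta0 D0 r0 Di0 H i.
have b1 : 1 <= b by apply: le_trans b_ge2; rewrite ler1n.
(* Each edge gives [D l' <= b * (eta + D l)]; the subtracted 1 closes the induction because
   [b >= 2]. *)
have [|k l l' ll' Dl|k km Di] :=
  @connect_ind_size (fun k l => eta + D l <= (2 * b ^+ k - 1) * eta) i0 _ _ i.
- by rewrite Di0 expr0; lra.
- have t : A l l' * D l' <= eta + D l.
    apply: le_trans (H l); rewrite (bigD1 l')//= -addrA lerDl addr_ge0// sumr_ge0// => k' _.
    by rewrite mulr_ge0.
  have : D l' <= b * ((2 * b ^+ k - 1) * eta).
    apply: (@le_trans _ _ (b * A l l' * D l')); first by rewrite ler_peMl ?A_edge.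
    by rewrite -mulrA ler_wpM2l ?(le_trans _ b_ge2)// (le_trans t).
  have : 0 <= (b - 2) * eta by rewrite mulr_ge0// subr_ge0.
  rewrite exprS; lra.
apply: (@le_trans _ _ (eta + D i)).
  apply: le_trans (H i); rewrite lerDr sumr_ge0// => j _; exact: mulr_ge0.
apply: le_trans Di _; rewrite ler_wpM2r//.
have : b ^+ k <= b ^+ m.-1 by rewrite ler_weXn2l//; lia.
lra.
Qed.

End Irreducible.

(** * Perturbation of a fixed point in a nonlinear block *)

Section Block.

Variables (R : realType) (m : nat) (Q : system R m).
Hypotheses (Q_MPS : is_MPS Q) (Q_quad : quadratic Q).
Variables (e : rel 'I_m) (b : R) (q v : 'I_m -> R).
Hypotheses (e_conn : forall i j, connect e i j) (b_ge2 : 2 <= b)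
  (q_gt0 : forall i, 0 < q i)
  (J_edge : forall i j, e i j -> 1 <= b * (Q i)^`M(j).@[fun k => q k / 2])
  (v_gt0 : forall i, 0 < v i)
  (v_cone : forall i, \sum_j (Q i)^`M(j).@[q] * v j <= v i).

Lemma edge_mderiv_ge x i j : (forall k, q k / 2 <= x k) -> e i j ->
  1 <= b * (Q i)^`M(j).@[x].
Proof.
move=> qx ij; apply: le_trans (J_edge ij) _; rewrite ler_wpM2l ?(le_trans _ b_ge2)//.
exact: mderiv_le.
Qed.

(** The exponent collects [m.-1] from [deficit_bound], twice [m.-1] from comparing [x i] with [x c]
    and with [x d], and one [b] for the quadratic coefficient. *)
Lemma fixpoint_perturbation (p : 'I_m -> R) eta k0 c d :
  (forall i, 0 <= p i <= q i) -> (forall i, (Q i).@[p] = p i) ->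
  (forall i, (Q i).@[q] <= q i <= (Q i).@[q] + eta) ->
  1 <= b * quad_coef (Q k0) c d ->
  forall i, (q i - p i) ^+ 2 <= 2 * b ^+ (3 * m.-1 + 1) * eta.
Proof.
move=> pq Qp Qq kcd i.
have p0 j : 0 <= p j by case/andP: (pq j).
have {}pq j : p j <= q j by case/andP: (pq j).
have q0 j : 0 <= q j by apply: ltW.
have b0 : 0 <= b by apply: le_trans b_ge2.
pose x j := q j - p j.
have x0 j : 0 <= x j by rewrite subr_ge0.
have eta0 : 0 <= eta by have /andP[] := Qq i; lra.
have quad : quad_part (Q k0) x x <= 2 * b ^+ m.-1 * eta.
  case: (@Order.TotalTheory.arg_maxP _ _ _ i xpredT (fun i => x i / v i)) => // k _ kmax.
  set t := x k / v k in kmax.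
  have tx j : x j <= t * v j by rewrite -ler_pdivrMr//; apply: kmax.
  have t0 : 0 <= t by rewrite divr_ge0// ltW.
  apply: (@deficit_bound _ _ e e_conn b b_ge2 (fun i j => (Q i)^`M(j).@[q]) _ _
    (fun j => t * v j - x j) (fun j => quad_part (Q j) x x) eta k) => //.
  - by move=> j l; apply: mderiv_ge0.
  - by move=> j l; apply: edge_mderiv_ge => h; have := q_gt0 h; lra.
  - by move=> j; rewrite subr_ge0.
  - by move=> j; apply: quad_part_ge0.
  - by rewrite /t divfK ?subrr// gt_eqF.
  move=> j.
  (* Expansion at [q] gives [x + H(x, x) <= J x + eta]. Together with [t J v <= t v] this is the
     inequality required of the deficit [t v - x]. *)
  have := taylor_quadratic p q (Q_quad j); rewrite Qp.
  have -> : quad_part (Q j) (fun j => p j - q j) (fun j => p j - q j) = quad_part (Q j) x x.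
    apply: eq_bigr => k1 _; apply: eq_bigr => k2 _; rewrite /x; ring.
  have -> : \sum_j0 (Q j)^`M(j0).@[q] * (p j0 - q j0) = - \sum_j0 (Q j)^`M(j0).@[q] * x j0.
    by rewrite -sumrN; apply: eq_bigr => k1 _; rewrite /x; ring.
  have -> : \sum_j0 (Q j)^`M(j0).@[q] * (t * v j0 - x j0) =
      t * \sum_j0 (Q j)^`M(j0).@[q] * v j0 - \sum_j0 (Q j)^`M(j0).@[q] * x j0.
    by rewrite mulr_sumr -sumrB; apply: eq_bigr => k1 _; ring.
  have := ler_wpM2l t0 (v_cone j); have /andP[_] := Qq j; rewrite /x; lra.
(* Here [x] is a supersolution for the Jacobian at the midpoint of [p] and [q], which is at least
   [q / 2], so its entries along edges are at least [1 / b]. *)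
have spread := @supersolution_spread _ _ e e_conn b b_ge2
  (fun i j => (Q i)^`M(j).@[fun k => (q k + p k) / 2]) _ _ x x0 _.
have {}spread j l : x l <= b ^+ m.-1 * x j.
  apply: spread => [{}j {}l|{}j {}l|{}j].
  - by apply: mderiv_ge0 => // k; rewrite divr_ge0// addr_ge0.
  - by apply: edge_mderiv_ge => k; have := p0 k; lra.
  - by rewrite -meval_midpoint// Qp lerD2r; case/andP: (Qq j).
have kcd' : quad_coef (Q k0) c d * (x c * x d) <= 2 * b ^+ m.-1 * eta.
  by apply: le_trans quad; apply: quad_part_ge.
have B0 : 0 <= b ^+ m.-1 by rewrite exprn_ge0.
apply: (@le_trans _ _ ((b ^+ m.-1 * x c) * (b ^+ m.-1 * x d))).
  by rewrite -/(x i) expr2; apply: ler_pM; rewrite ?x0 ?spread.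
apply: (@le_trans _ _ (b ^+ m.-1 * b ^+ m.-1 * b * (2 * b ^+ m.-1 * eta))).
  rewrite [leLHS]mulrACA -[leRHS]mulrA ler_wpM2l ?mulr_ge0//.
  apply: le_trans (ler_wpM2l b0 kcd').
  by rewrite [leRHS](mulrA b) ler_peMl ?mulr_ge0.
by rewrite addn1 exprS mulnC exprM !exprS expr0 le_eqVlt; apply/orP; left; apply/eqP; ring.
Qed.

End Block.

(** * Rounding errors *)

Section RoundDown.

Variables (R : realType) (h : nat).

Lemma round_down_ge0 (x : R) : 0 <= round_down h x.
Proof. by rewrite /round_down divr_ge0// exprn_ge0. Qed.

Lemma round_down_geB (x : R) : x - 2^-1 ^+ h <= round_down h x.
Proof.
have p2 : 0 < 2 ^+ h :> R by rewrite exprn_gt0.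
rewrite /round_down exprVn; set y := Num.max x 0.
have xy : x <= y by rewrite le_max lexx.
have y0 : 0 <= y by rewrite le_max lexx orbT.
rewrite ler_pdivlMr// mulrBl mulVf ?gt_eqF//.
have := truncnS_gt (2 ^+ h * y); rewrite -natr1 => t.
have : x * 2 ^+ h <= y * 2 ^+ h by rewrite ler_pM2r.
by move: t; rewrite [2 ^+ h * y]mulrC; lra.
Qed.

End RoundDown.

(** * Rounded Newton iteration on a nonlinear block *)

Section NewtonStep.

Variables (R : realType) (m : nat) (Q : system R m).
Hypotheses (Q_MPS : is_MPS Q) (Q_quad : quadratic Q).
Variables (e : rel 'I_m) (x0 p v : 'I_m -> R) (k0 c d : 'I_m).
Hypotheses (e_conn : forall i j, connect e i j)
  (J_edge : forall i j, e i j -> 0 < (Q i)^`M(j).@[x0])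
  (Q_nonlinear : 0 < quad_coef (Q k0) c d)
  (p_fix : forall i, (Q i).@[p] = p i)
  (v_gt0 : forall i, 0 < v i)
  (v_cone : forall i, \sum_j (Q i)^`M(j).@[p] * v j <= v i).

(** Rows without quadratic part have the same derivatives at [z] as at [x0], positive along every
    edge. A nonempty [Z] would therefore be closed under edges and contain the nonlinear row
    [k0]. *)
Lemma no_closed_linear (z : 'I_m -> R) (Z : pred 'I_m) :
  (forall i, Z i -> (forall l k, quad_coef (Q i) l k = 0) /\
    forall j, 0 < (Q i)^`M(j).@[z] -> Z j) ->
  forall i, ~~ Z i.
Proof.
move=> ZP i; apply/negP => Zi.
have /ZP[+ _] : Z k0; last by move=> /(_ c d) E; move: Q_nonlinear; rewrite E ltxx.
apply: (closed_full e_conn Zi) => j l jl /ZP[q0]; apply.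
suff -> : (Q j)^`M(l).@[z] = (Q j)^`M(l).@[x0] by apply: J_edge.
apply/eqP; rewrite -subr_eq0 mderiv_quadraticB// big1 ?mulr0// => k _.
by rewrite q0 mul0r.
Qed.

(** With [x = p - z], the new error [u] solves [u = A u + H(x, x)] for [A = J(z)], while
    [A v <= v - 2 H(x, v)]. If [x <= t v], then [H(x, x) <= t H(x, v)], so [t / 2 * v] is a
    supersolution of the same equation and dominates [u]. *)
Lemma newton_step (z : 'cV[R]_m) : (forall i, 0 <= z i 0 < p i) ->
  exists w : 'cV[R]_m,
    [/\ newton Q z = Some w, forall i, w i 0 < p i
      & forall t, (forall i, p i - z i 0 <= t * v i) ->
          forall i, p i - w i 0 <= t / 2 * v i].
Proof.
move=> zp; pose zf j := z j 0; pose x j := p j - zf j.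
have z0 j : 0 <= zf j by case/andP: (zp j).
have x_gt0 j : 0 < x j by rewrite subr_gt0; case/andP: (zp j).
have xp j : 0 <= x j by apply: ltW.
have zlep j : zf j <= p j by rewrite -subr_ge0; apply: xp.
pose A i j := (Q i)^`M(j).@[zf].
have A0 i j : 0 <= A i j by apply: mderiv_ge0.
have AE i : \sum_j A i j * v j =
    \sum_j (Q i)^`M(j).@[p] * v j - 2 * quad_part (Q i) x v.
  rewrite -(mderiv_quad_part (Q_quad i) p zf) -sumrB.
  by apply: eq_bigr => j _; rewrite /A; ring.
have Av i : \sum_j A i j * v j <= v i.
  have H0 : 0 <= quad_part (Q i) x v by apply: quad_part_ge0 => // j; exact: ltW.
  by rewrite AE; have := v_cone i; lra.
(* A row with [A v = v] has [H(x, v) = 0], hence no quadratic part, since [x] and [v] are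
   positive. *)
have pos u : (forall i, \sum_j A i j * u j <= u i) -> forall i, 0 <= u i.
  apply: (mmatrix_ge0 A0 v_gt0 Av) => Z ZP; apply: (@no_closed_linear zf) => i /ZP[ZE ZA].
  split=> // l k; apply: (quad_part_eq0 (Q_MPS i) x_gt0 v_gt0).
  by have := v_cone i; move: ZE; rewrite AE; lra.
have JE : jacobian Q z = \matrix_(i, j) A i j by apply/matrixP => i j; rewrite !mxE.
have U : 1%:M - jacobian Q z \in unitmx.
  apply: unitmx_1B => u Au; apply: pos => i; apply: le_trans (Au i).
  by apply: ler_sum => j _; rewrite JE mxE.
set w := invmx (1%:M - jacobian Q z) *m (eval Q z - z).
have wE i : w i 0 = \sum_j A i j * w j 0 + ((Q i).@[zf] - zf i).
  rewrite {1}/w invmx_1BE// -/w !mxE; congr (_ + _).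
  by apply: eq_bigr => j _; rewrite JE mxE.
exists (z + w); rewrite /newton U.
pose u i := p i - (z + w) i 0.
have uE i : u i = \sum_j A i j * u j + quad_part (Q i) x x.
  have -> : \sum_j A i j * u j = \sum_j A i j * x j - \sum_j A i j * w j 0.
    by rewrite -sumrB; apply: eq_bigr => j _; rewrite /u mxE /x /zf; ring.
  have := taylor_quadratic p zf (Q_quad i); rewrite p_fix => T.
  by rewrite {1}/u mxE wE T /A /x /zf; ring.
have H0 i : 0 <= quad_part (Q i) x x by apply: quad_part_ge0.
have u0 : forall i, 0 <= u i.
  by apply: pos => i; rewrite [leRHS]uE lerDl.
have Au0 i : 0 <= \sum_j A i j * u j by apply: sumr_ge0 => j _; rewrite mulr_ge0.
split=> // [i|t xt i].
  rewrite -subr_gt0 -/(u i) lt_def u0 andbT.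
  (* A zero of [u] forces [H(x, x) = 0] in its row and propagates along positive entries. The strict
     inequality obtained is what makes [x] positive at the next step. *)
  apply: (@no_closed_linear zf (fun i => u i == 0)) => k /eqP uk.
  split=> [|j Akj].
    apply: (quad_part_eq0 (Q_MPS k) x_gt0 x_gt0).
    by have := uE k; rewrite uk; have := Au0 k; lra.
  have S0 : \sum_j A k j * u j = 0.
    by have := uE k; rewrite uk; have := Au0 k; have := H0 k; lra.
  have /eqP := psumr_eq0P (fun l _ => mulr_ge0 (A0 k l) (u0 l)) S0 (i := j) isT.
  by rewrite mulf_eq0 gt_eqF.
rewrite -subr_ge0; apply: (pos (fun i => t / 2 * v i - u i)) => k.
have -> : \sum_j A k j * (t / 2 * v j - u j) =
    t / 2 * \sum_j A k j * v j - \sum_j A k j * u j.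
  by rewrite mulr_sumr -sumrB; apply: eq_bigr => j _; ring.
have : quad_part (Q k) x x <= t * quad_part (Q k) x v.
  rewrite /quad_part mulr_sumr; apply: ler_sum => j _.
  rewrite mulr_sumr; apply: ler_sum => l _.
  by rewrite [leRHS]mulrCA ler_wpM2l ?quad_coef_ge0// [leRHS]mulrCA ler_wpM2l// xt.
have t0 : 0 <= t.
  by rewrite -(pmulr_lge0 _ (v_gt0 k)) (le_trans (xp k))//; exact: xt.
by rewrite AE; have := ler_wpM2l t0 (v_cone k); have := uE k; lra.
Qed.

(** The factor [t] starts at 1, as [p <= 1 <= v]. Each step halves it and adds at most [2^-h] by
    rounding, so the accumulated rounding stays below [2 * 2^-h]. *)
Lemma rnm_nonlinear (h g : nat) :
  (forall i, 0 < p i <= 1) -> (forall i, 1 <= v i) ->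
  exists z : 'cV[R]_m,
    [/\ rnm h Q g = Some z, forall i, 0 <= z i 0 < p i
      & forall i, p i - z i 0 <= (2^-1 ^+ g + 2 * 2^-1 ^+ h) * v i].
Proof.
move=> p01 v1; have h0 : 0 <= 2^-1 ^+ h :> R by rewrite exprn_ge0 ?invr_ge0.
elim: g => [|g [z [Ez zp zv]]].
  exists 0; split=> [//|i|i]; rewrite mxE.
    by rewrite lexx; case/andP: (p01 i).
  have /andP[_ p1] := p01 i; rewrite subr0 expr0.
  apply: (le_trans p1); apply: (@le_trans _ _ (1 * v i)); first by rewrite mul1r.
  by rewrite ler_wpM2r ?lerDl ?mulr_ge0// (le_trans _ (v1 i)).
have [w [Ew wp wv]] := newton_step zp.
exists (map_mx (round_down h) w); split=> [|i|i].
- by rewrite /rnm/= -/(rnm h Q g) Ez /= /rnm_step Ew.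
- rewrite mxE round_down_ge0/=; have [le_r _] := round_down_spec h (w i 0).
  by apply: le_lt_trans le_r _; rewrite gt_max wp; case/andP: (p01 i).
rewrite mxE; have := wv _ zv i; have := round_down_geB h (w i 0).
have := ler_wpM2l h0 (v1 i); rewrite exprS; lra.
Qed.

End NewtonStep.

(** * The Newton step on a linear block *)

Section LinearBlock.

Variables (R : realType) (m : nat) (Q : system R m).
Hypotheses (Q_MPS : is_MPS Q) (Q_quad : quadratic Q).
Variables (e : rel 'I_m) (b rho eta : R) (q : 'I_m -> R) (k0 : 'I_m).
Hypotheses (e_conn : forall i j, connect e i j) (b_ge2 : 2 <= b)
  (J_edge : forall i j, e i j -> 1 <= b * (Q i)^`M(j).@[q])
  (Q_linear : forall i j k, quad_coef (Q i) j k = 0)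
  (q_gt0 : forall i, 0 < q i <= 1)
  (q_pert : forall i, (Q i).@[q] <= q i <= (Q i).@[q] + eta)
  (rho_gt0 : 0 < rho)
  (q_strict : rho <= q k0 - \sum_j (Q k0)^`M(j).@[q] * q j).

(** The step from 0 lands on the fixed point [w] of the linear system, so [x = q - w] solves
    [x = A x + (q - Q(q))] with a residual between 0 and [eta]. *)
Lemma newton_linear : exists w : 'cV[R]_m,
  [/\ newton Q 0 = Some w, forall i, 0 <= w i 0 <= q i
    & forall i, (q i - w i 0) * rho <= 2 * b ^+ m.-1 * eta].
Proof.
pose A i j := (Q i)^`M(j).@[q].
have q0 j : 0 < q j by case/andP: (q_gt0 j).
have qge0 j : 0 <= q j by apply: ltW.
have b0 : 0 < b by apply: lt_le_trans b_ge2.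
have A0 i j : 0 <= A i j by apply: mderiv_ge0.
have zf j : (0 : 'cV[R]_m) j 0 = 0 by rewrite mxE.
have JE i j : jacobian Q 0 i j = A i j.
  rewrite mxE; apply/eqP; rewrite -subr_eq0 mderiv_quadraticB// big1 ?mulr0// => k _.
  by rewrite Q_linear mul0r.
have QE i : (Q i).@[q] = eval Q 0 i 0 + \sum_j A i j * q j.
  rewrite mxE (taylor_quadratic q (fun j => (0 : 'cV[R]_m) j 0))//.
  rewrite [X in _ + X]big1 ?addr0; last first.
    by move=> j _; rewrite big1// => k _; rewrite Q_linear mul0r.
  by congr (_ + _); apply: eq_bigr => j _; rewrite zf subr0 -JE mxE.
have b_ge0 i : 0 <= eval Q 0 i 0 by rewrite mxE; apply: meval_ge0 => // j; rewrite zf.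
have Aq i : \sum_j A i j * q j <= q i.
  by have /andP[+ _] := q_pert i; rewrite QE; have := b_ge0 i; lra.
(* Edges are positive entries of [A], so a nonempty closed set of rows with equality would contain
   [k0], where the inequality is strict. *)
have pos u : (forall i, \sum_j A i j * u j <= u i) -> forall i, 0 <= u i.
  apply: (mmatrix_ge0 A0 q0 Aq) => Z ZP i; apply/negP => Zi.
  have /ZP[E _] : Z k0; last by move: q_strict rho_gt0; rewrite E; lra.
  apply: (closed_full e_conn Zi) => j l jl /ZP[_]; apply.
  by rewrite -(pmulr_rgt0 _ b0); apply: lt_le_trans (J_edge jl).
have U : 1%:M - jacobian Q 0 \in unitmx.
  apply: unitmx_1B => u Au; apply: pos => i; apply: le_trans (Au i).
  by apply: ler_sum => j _; rewrite JE.
set w := invmx (1%:M - jacobian Q 0) *m (eval Q 0 - 0).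
have wE i : w i 0 = \sum_j A i j * w j 0 + eval Q 0 i 0.
  rewrite {1}/w invmx_1BE// -/w subr0; congr (_ + _).
  by apply: eq_bigr => j _; rewrite JE.
pose x i := q i - w i 0.
have xE i : x i = \sum_j A i j * x j + (q i - (Q i).@[q]).
  have -> : \sum_j A i j * x j = \sum_j A i j * q j - \sum_j A i j * w j 0.
    by rewrite -sumrB; apply: eq_bigr => j _; rewrite /x; ring.
  by rewrite {1}/x wE QE; ring.
have w0 : forall i, 0 <= w i 0 by apply: pos => i; rewrite [leRHS]wE lerDl.
have x0 : forall i, 0 <= x i.
  by apply: pos => i; rewrite [leRHS]xE lerDl subr_ge0; case/andP: (q_pert i).
exists w; split=> [|i|i].
- by rewrite /newton U add0r.
- by rewrite w0 -subr_ge0 x0.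
case: (@Order.TotalTheory.arg_maxP _ _ _ i xpredT (fun i => x i / q i)) => // k _ kmax.
set t := x k / q k in kmax.
have tx j : x j <= t * q j by rewrite -ler_pdivrMr//; apply: kmax.
have t0 : 0 <= t by rewrite divr_ge0 ?x0.
have eta0 : 0 <= eta by have /andP[] := q_pert i; lra.
(* The deficit is [t q - x], with row slack [t (q - A q)]. At [k0] the slack is at least [t * rho],
   and [x i <= t] because [q <= 1]. *)
have D := @deficit_bound _ _ e e_conn b b_ge2 A A0 J_edge
    (fun j => t * q j - x j) (fun j => t * (q j - \sum_l A j l * q l)) eta k eta0.
apply: (@le_trans _ _ (t * (q k0 - \sum_l A k0 l * q l))).
  apply: ler_pM; [exact: x0|exact: ltW| |exact: q_strict].
  by apply: le_trans (tx i) _; rewrite ler_piMr//; case/andP: (q_gt0 i).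
apply: D => [j|j||j].
- by rewrite subr_ge0.
- by rewrite mulr_ge0// subr_ge0.
- by rewrite /t divfK ?subrr// gt_eqF.
have -> : \sum_l A j l * (t * q l - x l) =
    t * \sum_l A j l * q l - \sum_l A j l * x l.
  by rewrite mulr_sumr -sumrB; apply: eq_bigr => l _; ring.
have := xE j; have /andP[_] := q_pert j; lra.
Qed.

Lemma rnm_linear h : exists z : 'cV[R]_m,
  [/\ rnm h Q 1 = Some z, forall i, 0 <= z i 0 <= q i
    & forall i, (q i - z i 0 - 2^-1 ^+ h) * rho <= 2 * b ^+ m.-1 * eta].
Proof.
have [w [Ew wq wb]] := newton_linear.
exists (map_mx (round_down h) w); split=> [|i|i].
- by rewrite /rnm/= /rnm_step Ew.
- rewrite mxE round_down_ge0/=; have [le_r _] := round_down_spec h (w i 0).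
  have /andP[w0 wq'] := wq i.
  by apply: le_trans le_r _; rewrite ge_max wq' (le_trans w0 wq').
rewrite mxE; apply: le_trans (wb i); rewrite ler_wpM2r ?(ltW rho_gt0)//.
by have := round_down_geB h (w i 0); lra.
Qed.

End LinearBlock.

(** * Difference formulas in degree two *)

Section QuadraticShift.

Variables (R : realType) (n : nat).

(** A central difference is exact in degree two. Derivatives of a substituted polynomial can thus be
    read off its values. *)
Lemma mderiv_shift (f : {mpoly R[n]}) x j : (msize f <= 3)%N ->
  f^`M(j).@[x] = (f.@[fun k => x k + (k == j)%:R] - f.@[fun k => x k - (k == j)%:R]) / 2.
Proof.
move=> sf; apply: (canRL (mulfK _)); first by rewrite pnatr_eq0.
rewrite meval_midpoint// (bigD1 j)//= big1 ?addr0; last first.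
  by move=> k kj; rewrite (negbTE kj) /=; ring.
rewrite eqxx /=; congr (_ * _); last by ring.
by apply: meval_eq => k; field.
Qed.

Lemma quad_coef_shift (f : {mpoly R[n]}) i j : (msize f <= 3)%N ->
  2 * quad_coef f i j = f^`M(i).@[fun k => (k == j)%:R] - f^`M(i).@[fun=> 0].
Proof.
move=> sf; rewrite mderiv_quadraticB// (bigD1 j)//= big1 ?addr0.
  by rewrite eqxx subr0 mulr1.
by move=> k kj; rewrite (negbTE kj) subr0 mulr0.
Qed.

Lemma msize_le2P (f : {mpoly R[n]}) : (msize f <= 3)%N ->
  reflect (forall j k, quad_coef f j k = 0) (msize f <= 2)%N.
Proof.
move=> sf; apply: (iffP idP) => [s2 j k|f0].
  rewrite /quad_coef; suff -> : f@_(U_(j) + U_(k)) = 0 by rewrite mul0r.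
  by apply/eqP; rewrite mcoeff_eq0; apply: msize_mdeg_ge; rewrite mdegD !mdeg1.
rewrite msizeE; apply/bigmax_leqP_seq => m ms _; rewrite ltn_neqAle.
have dm := leq_trans (msize_mdeg_lt ms) sf; rewrite -ltnS dm andbT.
apply/eqP => m2; have [a [b E]] := mdeg2P m2; move: ms; rewrite mcoeff_msupp E.
have /eqP := f0 a b; rewrite /quad_coef mulf_eq0 invr_eq0 => /orP[->//|].
by rewrite gt_eqF// ltr_wpDr.
Qed.

End QuadraticShift.

(** * Restriction of the system to a set of variables *)

Section Subsystem.

Variables (R : realType) (n : nat) (P : system R n) (S : {set 'I_n}).
Hypotheses (P_MPS : is_MPS P) (P_quad : quadratic P).

(** The form of [set_block] on functions, suited to evaluation. *)
Definition block (x : 'I_#|S| -> R) (y : 'cV[R]_n) (j : 'I_n) : R :=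
  if scc_index S j is Some k then x k else y j 0.

Lemma scc_index_enum_val k : scc_index S (enum_val k) = Some k.
Proof.
rewrite /scc_index; case: pickP => [l /eqP/enum_val_inj->//|/(_ k)].
by rewrite eqxx.
Qed.

Lemma scc_index_notin j : j \notin S -> scc_index S j = None.
Proof.
move=> jS; rewrite /scc_index; case: pickP => // k /eqP E.
by move: jS; rewrite -E enum_valP.
Qed.

Lemma block_in x y k : block x y (enum_val k) = x k.
Proof. by rewrite /block scc_index_enum_val. Qed.

Lemma block_notin x y j : j \notin S -> block x y j = y j 0.
Proof. by move=> jS; rewrite /block scc_index_notin. Qed.

Lemma block_ind x (y : 'cV[R]_n) (T : 'I_n -> R -> Prop) :
  (forall k, T (enum_val k) (x k)) -> (forall j, j \notin S -> T j (y j 0)) ->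
  forall j, T j (block x y j).
Proof.
move=> Tx Ty j; have [jS|jS] := boolP (j \in S); last by rewrite block_notin//; apply: Ty.
by rewrite -(enum_rankK_in jS jS) block_in; apply: Tx.
Qed.

Definition subst_poly (y : 'cV[R]_n) (j : 'I_n) : {mpoly R[#|S|]} :=
  if scc_index S j is Some l then 'X_l else (y j 0)%:MP.

Lemma subsystemE y k : @subsystem R n P S y k =
  ((P (enum_val k))@_0)%:MP + \sum_j (P (enum_val k))@_U_(j) *: subst_poly y j
  + \sum_j \sum_l quad_coef (P (enum_val k)) j l *: (subst_poly y j * subst_poly y l).
Proof.
rewrite /subsystem; set t := mktuple _.
have tE j : 'X_j \mPo t = subst_poly y j.
  by rewrite comp_mpolyXU -tnth_nth tnth_mktuple.
rewrite {1}(quadratic_mpolyE (P_quad (enum_val k))) !comp_mpolyD comp_mpolyC.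
congr (_ + _ + _).
  by rewrite (raddf_sum (comp_mpoly t))/=; apply: eq_bigr => j _; rewrite comp_mpolyZ tE.
rewrite (raddf_sum (comp_mpoly t))/=; apply: eq_bigr => j _.
rewrite (raddf_sum (comp_mpoly t))/=; apply: eq_bigr => l _.
by rewrite comp_mpolyZ rmorphM/= !tE.
Qed.

Lemma meval_subsystem y k x :
  (@subsystem R n P S y k).@[x] = (P (enum_val k)).@[block x y].
Proof.
rewrite /subsystem comp_mpoly_meval; apply: meval_eq => j; rewrite tnth_mktuple /block.
by case: scc_index => [l|]; rewrite ?mevalXU ?mevalC.
Qed.

Lemma msize_subst_poly y j : (msize (subst_poly y j) <= 2)%N.
Proof.
rewrite /subst_poly; case: scc_index => [l|]; first by rewrite msizeX mdeg1.
by rewrite msizeC; case: eqP.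
Qed.

Lemma subsystem_quadratic y : quadratic (@subsystem R n P S y).
Proof.
move=> k; rewrite subsystemE.
apply: leq_trans (msizeD_le _ _) _; rewrite geq_max; apply/andP; split.
  apply: leq_trans (msizeD_le _ _) _; rewrite geq_max msizeC; apply/andP; split; first by case: eqP.
  apply: leq_trans (msize_sum _ _ _) _; apply/bigmax_leqP => j _.
  by apply: leq_trans (msizeZ_le _ _) _; apply: leqW; apply: msize_subst_poly.
apply: leq_trans (msize_sum _ _ _) _; apply/bigmax_leqP => j _.
apply: leq_trans (msize_sum _ _ _) _; apply/bigmax_leqP => l _.
apply: leq_trans (msizeZ_le _ _) _.
have [->|j0] := eqVneq (subst_poly y j) 0; first by rewrite mul0r msize0.
have [->|l0] := eqVneq (subst_poly y l) 0; first by rewrite mulr0 msize0.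
by rewrite msizeM// -subn1 leq_subLR (leq_add (msize_subst_poly y j) (msize_subst_poly y l)).
Qed.

Lemma subsystem_MPS (y : 'cV[R]_n) : (forall j, 0 <= y j 0) -> is_MPS (@subsystem R n P S y).
Proof.
move=> y0 k m; rewrite subsystemE !mcoeffD.
have t0 j m' : 0 <= (subst_poly y j)@_m'.
  rewrite /subst_poly; case: scc_index => [l|]; first by rewrite mcoeffX.
  by rewrite mcoeffC mulr_ge0.
rewrite !addr_ge0//.
- by rewrite mcoeffC mulr_ge0.
- by rewrite (raddf_sum (mcoeff m))/= sumr_ge0// => j _; rewrite mcoeffZ mulr_ge0.
rewrite (raddf_sum (mcoeff m))/= sumr_ge0// => j _.
rewrite (raddf_sum (mcoeff m))/= sumr_ge0// => l _; rewrite mcoeffZ mulr_ge0 ?quad_coef_ge0//.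
by rewrite mcoeffM sumr_ge0// => ? _; rewrite mulr_ge0.
Qed.

(** Shifting one coordinate commutes with [block], so the two central differences agree. *)
Lemma mderiv_subsystem y k l x :
  (@subsystem R n P S y k)^`M(l).@[x] = (P (enum_val k))^`M(enum_val l).@[block x y].
Proof.
have blockE s : block (fun k => x k + s * (k == l)%:R) y =1
    (fun j => block x y j + s * (j == enum_val l)%:R).
  apply: (block_ind (T := fun j r => r = _ + _)) => [k'|j jS].
    by rewrite block_in (inj_eq enum_val_inj).
  rewrite block_notin//; case: eqP => [E|_]; last by rewrite mulr0 addr0.
  by move: jS; rewrite E enum_valP.
rewrite (mderiv_shift _ _ (subsystem_quadratic y k)) (mderiv_shift _ _ (P_quad _)).
rewrite !meval_subsystem; congr ((_ - _) / 2); apply: meval_eq => j.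
  by have := blockE 1 j; rewrite mul1r => <-; rewrite /block; case: scc_index => // ?; rewrite mul1r.
by have := blockE (-1) j; rewrite mulN1r => <-; rewrite /block; case: scc_index => // ?; rewrite mulN1r.
Qed.

Lemma quad_coef_subsystem y k l l' :
  quad_coef (@subsystem R n P S y k) l l' =
  quad_coef (P (enum_val k)) (enum_val l) (enum_val l').
Proof.
apply: (@mulfI _ (2 : R)) => /=; first by rewrite pnatr_eq0.
rewrite quad_coef_shift; last exact: subsystem_quadratic.
rewrite !mderiv_subsystem mderiv_quadraticB//; congr (_ * _).
rewrite (bigD1 (enum_val l'))//= !block_in eqxx subr0 mulr1 big1 ?addr0// => j jl.
suff -> : block (fun k0 => (k0 == l')%:R) y j = block (fun=> 0) y j by rewrite subrr mulr0.
rewrite /block /scc_index; case: pickP => // k' /eqP E.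
by move: jl; rewrite -E (inj_eq enum_val_inj) => /negbTE->.
Qed.

(** The coefficients of degree two inside [S] are those of [P] whatever values are inserted, so the
    test made at the LFP also classifies the system at the approximate values. *)
Lemma linear_sccP q : reflect
  (forall k l l' : 'I_#|S|, quad_coef (P (enum_val k)) (enum_val l) (enum_val l') = 0)
  (linear_scc P q S).
Proof.
apply: (iffP forallP) => [H k l l'|H k].
  by rewrite -(quad_coef_subsystem q); apply/(msize_le2P (subsystem_quadratic q k)).
by apply/(msize_le2P (subsystem_quadratic q k)) => l l'; rewrite quad_coef_subsystem.
Qed.

End Subsystem.

(** * Minima of sequences *)

Section SeqMin.

Variable R : realType.
Implicit Type s : seq R.

Lemma seq_min_le s x : x \in s -> seq_min s <= x.
Proof. by move=> xs; apply: (@ge_bigmin_seq _ _ _ _ _ x xpredT id). Qed.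

Lemma seq_min_gt0 s : s != [::] -> (forall x, x \in s -> 0 < x) -> 0 < seq_min s.
Proof.
move=> s0 sp; rewrite /seq_min big_seq; apply: (big_ind (fun x => 0 < x)) => //.
  by case: s s0 sp => //= x s _; apply; rewrite mem_head.
by move=> x y x0 y0; rewrite lt_min x0.
Qed.

End SeqMin.

(** * Quantitative bounds in terms of [alpha] *)

Section Dependency.

Variables (R : realType) (n : nat) (P : system R n) (q : 'cV[R]_n).
Hypotheses (P_MPS : is_MPS P) (P_quad : quadratic P).
Hypotheses (q_fix : eval P q = q)
  (q_gt0 : forall i, 0 < q i 0) (q_le1 : forall i, q i 0 <= 1).

Local Notation qf := (fun j => q j 0).
Local Notation b := (alpha P q)^-1.

Lemma meval_fix i : (P i).@[qf] = q i 0.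
Proof. by rewrite -[in RHS]q_fix mxE. Qed.

Lemma cmin_le i m : (P i)@_m != 0 -> cmin P <= (P i)@_m.
Proof.
move=> Pim; apply: seq_min_le; apply/allpairsPdep.
by exists i, m; rewrite mem_enum mcoeff_msupp.
Qed.

Variable i0 : 'I_n.

Lemma cmin_gt0 : 0 < cmin P.
Proof.
apply: seq_min_gt0 => [|x /allpairsPdep[i [m [_ mP ->]]]]; last first.
  by rewrite lt_def P_MPS andbT -mcoeff_msupp.
have P0 : P i0 != 0.
  by apply: contraTneq (q_gt0 i0) => E; rewrite -meval_fix E meval0 ltxx.
have [m mP] : exists m, m \in msupp (P i0).
  by case E : (msupp (P i0)) => [|m s]; [move/eqP: E; rewrite msupp_eq0 (negbTE P0)|exists m; rewrite mem_head].
have : (P i0)@_m \in [seq (P i)@_m | i <- enum 'I_n, m <- msupp (P i)].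
  by apply/allpairsPdep; exists i0, m; rewrite mem_enum.
by apply: contraTneq => ->.
Qed.

Lemma qmin_le i : qmin q <= q i 0.
Proof. by apply: seq_min_le; apply/mapP; exists i; rewrite ?mem_enum. Qed.

Lemma qmin_gt0 : 0 < qmin q.
Proof.
apply: seq_min_gt0 => [|x /mapP[i _ ->]//].
by rewrite -size_eq0 size_map size_enum_ord; case: n i0 => // -[].
Qed.

Lemma alpha_gt0 : 0 < alpha P q.
Proof. by rewrite /alpha !mulr_gt0 ?qmin_gt0 ?invr_gt0// lt_min ltr01 cmin_gt0. Qed.

Lemma alpha_le i : alpha P q <= q i 0 / 2.
Proof.
have qm := qmin_gt0; have qi := qmin_le i.
have m1 : Num.min 1 (cmin P) <= 1 by rewrite ge_min lexx.
have : Num.min 1 (cmin P) * (2^-1 * qmin q) <= 1 * (2^-1 * qmin q).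
  by rewrite ler_wpM2r// mulr_ge0 ?invr_ge0 ?(ltW qm).
rewrite /alpha; lra.
Qed.

Lemma alpha_le_coef i m (x : R) : (P i)@_m != 0 -> qmin q / 2 <= x -> alpha P q <= (P i)@_m * x.
Proof.
move=> Pim qx; have qm := qmin_gt0; rewrite /alpha; apply: ler_pM.
- by rewrite le_min ler01 ltW ?cmin_gt0.
- by rewrite mulr_ge0 ?invr_ge0 ?(ltW qm).
- by rewrite ge_min cmin_le ?orbT.
by rewrite mulrC.
Qed.

Lemma alphaV_ge2 : 2 <= b.
Proof.
rewrite -[leLHS]invrK lef_pV2 ?posrE ?invr_gt0 ?alpha_gt0//.
by have := alpha_le i0; have := q_le1 i0; lra.
Qed.

Lemma alphaV_gt0 : 0 < b.
Proof. by rewrite invr_gt0 alpha_gt0. Qed.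

Lemma alphaV_mul_ge1 (x : R) : (1 <= b * x) = (alpha P q <= x).
Proof. by rewrite mulrC ler_pdivlMr ?alpha_gt0// mul1r. Qed.

Lemma quad_coef_weight (j k : 'I_n) : 2^-1 <= (1 + (j != k)%:R)^-1 :> R.
Proof. by case: (j != k); rewrite //= addr0 invr1; lra. Qed.

(** The factor 1/2 in [alpha] pays for the weight 1/2 of off-diagonal coefficients. *)
Lemma alphaV_quad_coef_ge1 i j k : quad_coef (P i) j k != 0 -> 1 <= b * quad_coef (P i) j k.
Proof.
rewrite alphaV_mul_ge1 /quad_coef mulf_eq0 negb_or => /andP[c0 _].
apply: alpha_le_coef => //; have := qmin_le i0; have := q_le1 i0.
by have := quad_coef_weight j k; lra.
Qed.

Lemma notdep_coef i j : ~~ dep_edge P i j -> forall m : 'X_{1..n}, (0 < m j)%N -> (P i)@_m = 0.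
Proof.
move=> /hasPn ndep m mj; apply/eqP; case: (eqVneq (P i)@_m 0) => // Pm.
have mP : m \in msupp (P i) by rewrite mcoeff_msupp.
by have := ndep m mP; rewrite mj lt_def Pm P_MPS.
Qed.

Lemma notdep_linear_coef i j : ~~ dep_edge P i j -> (P i)@_U_(j) = 0.
Proof. by move=> nd; apply: (notdep_coef nd); rewrite mnm1E eqxx. Qed.

Lemma notdep_quad_coef i j k : ~~ dep_edge P i j -> quad_coef (P i) j k = 0.
Proof.
by move=> nd; rewrite /quad_coef (notdep_coef nd) ?mul0r// mnmDE mnm1E eqxx.
Qed.

(** The edge comes from a monomial [x_j] or [x_j x_k]. In the second case [k] is a successor of [i]
    too, so [x k >= q k / 2] and the derivative is at least [cmin * qmin / 2]. *)
Lemma alphaV_edge_ge1 i j x : dep_edge P i j -> (forall k, 0 <= x k) ->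
  (forall k, dep_edge P i k -> q k 0 / 2 <= x k) -> 1 <= b * (P i)^`M(j).@[x].
Proof.
move=> /hasP[m mP /andP[Pm mj]] x0 xq; rewrite alphaV_mul_ge1 mderiv_quadratic//.
have Q0 k : 0 <= 2 * (quad_coef (P i) j k * x k) by rewrite mulr_ge0// mulr_ge0 ?x0 ?(quad_coef_ge0 (P_MPS i)).
have Pm0 : (P i)@_m != 0 by rewrite gt_eqF.
have dm := leq_trans (msize_mdeg_lt mP) (P_quad i).
case dE : (mdeg m) dm => [|[|[|//]]] _.
- by move: dE mj => /eqP; rewrite mdeg_eq0 => /eqP ->; rewrite mnm0E.
- have /mdeg1P[l /eqP ml] : mdeg m == 1%N by rewrite dE.
  have jl : l = j by move: mj; rewrite ml mnm1E; case: eqP.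
  rewrite ml jl in Pm0; apply: (@le_trans _ _ (P i)@_U_(j)).
    rewrite -[leRHS]mulr1; apply: alpha_le_coef => //.
    by have := qmin_le i0; have := q_le1 i0; lra.
  by rewrite lerDl mulr_sumr sumr_ge0.
have [k mk] : exists k, m = (U_(j) + U_(k))%MM.
  have [c [d E]] := mdeg2P dE; move: mj; rewrite E mnmDE !mnm1E.
  have [->|_] := eqVneq c j; first by exists d.
  by have [->|//] := eqVneq d j; exists c; rewrite addmC.
have kd : dep_edge P i k.
  by apply/hasP; exists m => //; rewrite Pm mk mnmDE !mnm1E eqxx addn1.
apply: (@le_trans _ _ (2 * (quad_coef (P i) j k * x k))).
  rewrite mk in Pm0; apply: le_trans (alpha_le_coef (x := x k) Pm0 _) _.
    by apply: le_trans (xq k kd); have := qmin_le k; lra.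
  rewrite mulrA ler_wpM2r// /quad_coef mulrCA ler_peMr//.
  by have := quad_coef_weight j k; lra.
by rewrite mulr_sumr (bigD1 k)//= addrCA lerDl addr_ge0 ?sumr_ge0.
Qed.

(** Replacing one factor at a time changes a product by at most [2 * delta], and the coefficients
    sum to the value at 1. Variables that are not successors of [i] have coefficient zero. *)
Lemma meval_perturbation i (w : 'I_n -> R) delta : 0 <= delta ->
  (forall j, 0 <= w j <= q j 0) ->
  (forall j, dep_edge P i j -> q j 0 - w j <= delta) ->
  q i 0 <= (P i).@[w] + 2 * (P i).@[fun=> 1] * delta.
Proof.
move=> d0 wq dw; rewrite -meval_fix !meval_quadratic//.
have w0 j : 0 <= w j by case/andP: (wq j).
have wl j : w j <= q j 0 by case/andP: (wq j).
have L : \sum_j (P i)@_U_(j) * q j 0 <=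
    \sum_j (P i)@_U_(j) * w j + (\sum_j (P i)@_U_(j) * 1) * delta.
  rewrite mulr_suml -big_split/=; apply: ler_sum => j _; rewrite mulr1 -mulrDr.
  have [jd|jd] := boolP (dep_edge P i j); last by rewrite notdep_linear_coef// !mul0r.
  by rewrite ler_wpM2l//; have := dw j jd; lra.
have H : quad_part (P i) qf qf <=
    quad_part (P i) w w + 2 * quad_part (P i) (fun=> 1) (fun=> 1) * delta.
  rewrite /quad_part -mulrA mulr_suml mulr_sumr -big_split/=; apply: ler_sum => j _.
  rewrite mulr_suml mulr_sumr -big_split/=; apply: ler_sum => k _.
  have [jd|jd] := boolP (dep_edge P i j); last by rewrite notdep_quad_coef// !mul0r mulr0 addr0.
  have [kd|kd] := boolP (dep_edge P i k); last first.
    by rewrite quad_coefC notdep_quad_coef// !mul0r mulr0 addr0.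
  have c0 := quad_coef_ge0 (P_MPS i) j k.
  have : q j 0 * q k 0 <= w j * w k + 2 * delta.
    have t1 : q j 0 * (q k 0 - w k) <= 1 * delta.
      by apply: ler_pM; rewrite ?subr_ge0 ?q_le1 ?dw// ltW.
    have t2 : w k * (q j 0 - w j) <= 1 * delta.
      by apply: ler_pM; rewrite ?subr_ge0 ?(le_trans (wl k)) ?q_le1 ?dw.
    lra.
  by move/(ler_wpM2l c0); lra.
have c0 : 0 <= (P i)@_0 * delta by rewrite mulr_ge0.
have L0 : 0 <= (\sum_j (P i)@_U_(j) * 1) * delta.
  by rewrite mulr_ge0// sumr_ge0// => j _; rewrite mulr1.
by lra.
Qed.

Lemma eval1_le_norm i : (P i).@[fun=> 1] <= norm_oo (eval P (const_mx 1)).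
Proof.
apply: le_trans (le_bigmax _ _ i); rewrite mxE; apply: le_trans (ler_norm _).
by rewrite (meval_eq (v2 := fun=> 1))// => j; rewrite mxE.
Qed.

(** The norm can be less than 1; this lower bound shows that one factor [b] suffices to
    compensate. *)
Lemma norm_eval1_ge : 2 * alpha P q <= norm_oo (eval P (const_mx 1)).
Proof.
apply: le_trans (eval1_le_norm i0); apply: (@le_trans _ _ (q i0 0)).
  by have := alpha_le i0; lra.
by rewrite -meval_fix; apply: meval_le => // j; exact: ltW.
Qed.

End Dependency.

(** * Strongly connected components *)

Section Components.

Variables (R : realType) (n : nat) (P : system R n).

Lemma mem_scc_of i : i \in scc_of P i.
Proof. by rewrite inE !connect0. Qed.

Lemma scc_of_in_sccs i : scc_of P i \in sccs P.
Proof. exact: imset_f. Qed.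

Variable S : {set 'I_n}.
Hypothesis S_scc : S \in sccs P.

Lemma scc_connected i j : i \in S -> j \in S -> connect (dep_edge P) i j.
Proof.
have /imsetP[k _ ->] := S_scc; rewrite !inE => /andP[_ ik] /andP[kj _].
exact: connect_trans ik kj.
Qed.

Lemma mem_scc_connect i j : i \in S -> connect (dep_edge P) i j ->
  connect (dep_edge P) j i -> j \in S.
Proof.
have /imsetP[k _ ->] := S_scc; rewrite !inE => /andP[ki ik] ij ji.
by rewrite (connect_trans ki ij) (connect_trans ji ik).
Qed.

Lemma scc_of_mem i : i \in S -> scc_of P i = S.
Proof.
move=> iS; apply/setP => j; rewrite inE; apply/andP/idP => [[ij ji]|jS].
  exact: mem_scc_connect iS ij ji.
by rewrite !scc_connected.
Qed.

Definition scc_dep : rel 'I_#|S| := fun k l => dep_edge P (enum_val k) (enum_val l).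

(** A path between two members of [S] never leaves [S]: each of its vertices reaches [S] and is
    reached from it. *)
Lemma scc_dep_connect k l : connect scc_dep k l.
Proof.
have kl := scc_connected (enum_valP k) (enum_valP l).
have /connectP[p] := kl; elim: p k {kl} => [|x p IH] k /=.
  by move=> _ /enum_val_inj ->.
move=> /andP[kx xp] lE.
have xl : connect (dep_edge P) x (enum_val l) by apply/connectP; exists p.
have xS : x \in S.
  apply: mem_scc_connect (enum_valP k) (connect1 kx) _.
  exact: connect_trans xl (scc_connected (enum_valP l) (enum_valP k)).
apply: (@connect_trans _ _ (enum_rank_in xS x)).
  by apply: connect1; rewrite /scc_dep enum_rankK_in.
by apply: IH; rewrite enum_rankK_in.
Qed.

Lemma scc_edge_out i j : i \in S -> j \notin S -> dep_edge P i j ->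
  scc_edge P S (scc_of P j).
Proof.
move=> iS jS ij; apply/andP; split.
  by apply: contraNneq jS => ->; exact: mem_scc_of.
by apply/existsP; exists i; rewrite iS; apply/existsP; exists j; rewrite mem_scc_of.
Qed.

End Components.

(** * A positive cone vector for a nonlinear component *)

Section ConeVector.

Variables (R : realType) (n : nat) (P : system R n) (q : 'cV[R]_n).
Hypotheses (P_MPS : is_MPS P) (P_quad : quadratic P) (q_LFP : is_LFP P q)
  (q_gt0 : forall i, 0 < q i 0) (q_le1 : forall i, q i 0 <= 1).

Local Notation qf := (fun j => q j 0).
Local Notation b := (alpha P q)^-1.

Let q_fix : eval P q = q. Proof. by case: q_LFP. Qed.

Lemma kleene_le_LFP k i : kleene P k i <= q i 0.
Proof.
apply: (kleene_le P_MPS P_quad (q := qf)) => j; first exact: ltW.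
by rewrite (meval_fix q_fix).
Qed.

Lemma kleene_LFP_cvg e : 0 < e ->
  exists M : nat, forall k i, (M <= k)%N -> q i 0 - kleene P k i <= e.
Proof.
move=> e0; have [||p [pq Pp _ cv]] := @kleene_limit _ _ P P_MPS P_quad qf.
- by move=> j; exact: ltW.
- by move=> j; rewrite (meval_fix q_fix).
have qp i : q i 0 <= p i.
  have [_ _ least] := q_LFP.
  have -> : p i = (\col_j p j : 'cV[R]_n) i 0 by rewrite mxE.
  apply: least => [|j]; last by rewrite mxE; case/andP: (pq j).
  apply/colP => j; rewrite !mxE -[RHS]Pp; apply: meval_eq => k; by rewrite mxE.
have [M HM] := cv e e0; exists M => k i Mk; apply: le_trans (HM k i Mk).
by rewrite lerD2r.
Qed.

Variable S : {set 'I_n}.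
Hypothesis S_scc : S \in sccs P.
Variables k0 c0 d0 : 'I_#|S|.
Hypothesis S_nonlinear :
  quad_coef (P (enum_val k0)) (enum_val c0) (enum_val d0) != 0.

Local Notation e := (@scc_dep R n P S).
Local Notation m := #|S|.

(** A nontrivial path to [k0] starts with a successor; when the path is trivial, the nonzero
    quadratic coefficient of row [k0] supplies one. *)
Lemma scc_dep_succ k : exists l, e k l.
Proof.
have /connectP[[_ kk|l p /= /andP[kl _] _]] := scc_dep_connect S_scc k k0; last by exists l.
exists c0; apply: contraTT S_nonlinear => nd; rewrite negbK; apply/eqP.
apply: (notdep_quad_coef P_MPS); move: nd; rewrite /scc_dep.
by rewrite kk.
Qed.

(** The positive error of one successor passes through the Jacobian at a midpoint that is at least
    [q / 2]. Strictness is what allows the errors to be normalised. *)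
Lemma kleene_lt_LFP t (k : 'I_m) : kleene P t (enum_val k) < q (enum_val k) 0.
Proof.
elim: t k => [|t IH] k; first exact: q_gt0.
rewrite -subr_gt0 -[in X in X - _](meval_fix q_fix) meval_midpoint//.
have [l kl] := scc_dep_succ k.
pose mid j := (q j 0 + kleene P t j) / 2.
have K0 j := kleene_ge0 P_MPS P_quad t j.
have mid0 j : 0 <= mid j by rewrite divr_ge0// addr_ge0// ltW.
have J0 j : 0 <= (P (enum_val k))^`M(j).@[mid] by apply: mderiv_ge0.
rewrite (bigD1 (enum_val l))//=; apply: ltr_wpDr.
  by apply: sumr_ge0 => j _; rewrite mulr_ge0 ?J0// subr_ge0 kleene_le_LFP.
rewrite mulr_gt0 ?subr_gt0 ?IH//.
have := alphaV_edge_ge1 P_MPS P_quad q_fix q_gt0 q_le1 (enum_val k) kl mid0 _.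
have bp := alphaV_gt0 P_MPS q_fix q_gt0 (enum_val k).
move=> /(_ _)/(lt_le_trans ltr01); rewrite pmulr_rgt0//; apply => j _.
by have := K0 j; rewrite /mid; lra.
Qed.

(** For the iterates [K_t] with errors [x_t], the tangent inequality gives
    [J(K_t) x_t <= x_(t+1) <= x_t] on [S]. This survives division by the sum and passes to a cluster
    point, with [J(K_t)] tending to [J(q)]. *)
Lemma cone_vector_nonneg : exists w : 'I_m -> R,
  [/\ forall k, 0 <= w k, exists k, 0 < w k
    & forall k, \sum_l (P (enum_val k))^`M(enum_val l).@[qf] * w l <= w k].
Proof.
pose x t (k : 'I_m) := q (enum_val k) 0 - kleene P t (enum_val k).
have x_gt0 t k : 0 < x t k by rewrite subr_gt0 kleene_lt_LFP.
pose s t := \sum_k x t k.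
have s_gt0 t : 0 < s t.
  by rewrite /s (bigD1 k0)//= ltr_pwDl ?sumr_ge0// => k _; exact: ltW.
pose v t k := x t k / s t.
have v01 t k : 0 <= v t k <= 1.
  apply/andP; split; rewrite /v; first by rewrite divr_ge0// ltW.
  rewrite ler_pdivrMr// mul1r /s (bigD1 k)//= lerDl sumr_ge0// => j _; exact: ltW.
have sv t : \sum_k v t k = 1 by rewrite /v -mulr_suml -/(s t) mulfV// gt_eqF.
have vJ t k : \sum_l (P (enum_val k))^`M(enum_val l).@[kleene P t] * v t l <= v t k.
  rewrite /v; under eq_bigr do rewrite mulrA; rewrite -mulr_suml ler_pM2r ?invr_gt0//.
  apply: (@le_trans _ _ (x t.+1 k)); last first.
    by rewrite lerD2l lerN2; apply: kleene_nondecreasing.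
  have := meval_ge_tangent (P_MPS (enum_val k)) (P_quad (enum_val k)) (kleene_le_LFP t).
  rewrite (meval_fix q_fix) -lerBrDl; apply: le_trans.
  rewrite -(big_enum_val (fun j => (P (enum_val k))^`M(j).@[kleene P t]
    * (q j 0 - kleene P t j))) [leRHS](bigID (mem S))/= lerDl sumr_ge0// => j _.
  rewrite mulr_ge0 ?subr_ge0 ?kleene_le_LFP//.
  by apply: mderiv_ge0 => // ?; apply: kleene_ge0.
have [w wc] := bounded_seq_cluster v01.
have q0 j : 0 <= q j 0 by exact: ltW.
have w0 k : 0 <= w k.
  rewrite -[w k]addr0 -lerBlDl sub0r; apply/ler_addgt0Pr => e e0; rewrite add0r.
  have [t _ /(_ k)] := wc e e0 0%N; rewrite ltr_norml => /andP[_].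
  by have /andP[] := v01 t k; lra.
exists w; split=> // [|k].
  (* If no entry were positive, some [v t] would have all entries at most [1 / (2m)], against their
     sum being 1. *)
  have [/existsP[k wk]|/existsPn wn] := boolP [exists k, 0 < w k]; first by exists k.
  pose r : R := (2 * m%:R)^-1.
  have m0 : 0 < m%:R :> R by rewrite ltr0n (leq_trans _ (ltn_ord k0)).
  have r0 : 0 < r by rewrite invr_gt0 mulr_gt0.
  have [t _ tw] := wc r r0 0%N.
  have : \sum_k v t k <= \sum_(k < m) r.
    apply: ler_sum => k _; have := tw k; have := wn k; rewrite -leNgt.
    by rewrite ltr_norml => ? /andP[]; lra.
  rewrite sv sumr_const card_ord -mulr_natl /r invfM mulrCA mulfV ?gt_eqF//.
  by rewrite mulr1; lra.
pose f := P (enum_val k).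
(* Error budget: [C * r] for replacing [w] by [v t], [C' * r] for replacing [J(q)] by the Jacobian
   at the iterate, and [r] for returning to [w]. *)
pose C : R := \sum_(l < m) f^`M(enum_val l).@[qf].
pose C' : R := 2 * \sum_(l < m) \sum_j quad_coef f (enum_val l) j.
have J0 l : 0 <= f^`M(l).@[qf] by apply: mderiv_ge0 => //; [exact: P_MPS|exact: P_quad].
have c_ge0 l j : 0 <= quad_coef f l j by apply: quad_coef_ge0; exact: P_MPS.
have C0 : 0 <= C by apply: sumr_ge0.
have C0' : 0 <= C'.
  by rewrite mulr_ge0// sumr_ge0// => l _; rewrite sumr_ge0.
apply/ler_addgt0Pr => e e0.
pose r := e / (C + C' + 1).
have CC : 0 < C + C' + 1 by rewrite ltr_wpDl// addr_ge0.
have r0 : 0 < r by rewrite divr_gt0.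
have [M HM] := kleene_LFP_cvg r0; have [t Mt tw] := wc r r0 M.
have s1 : \sum_l f^`M(enum_val l).@[qf] * w l <=
    \sum_l f^`M(enum_val l).@[qf] * v t l + C * r.
  rewrite mulr_suml -big_split/=; apply: ler_sum => l _; rewrite -mulrDr.
  rewrite ler_wpM2l//; have := tw l; rewrite ltr_norml => /andP[]; lra.
have s2 : \sum_l f^`M(enum_val l).@[qf] * v t l <=
    \sum_l f^`M(enum_val l).@[kleene P t] * v t l + C' * r.
  rewrite -mulrA mulr_suml mulr_sumr -big_split/=; apply: ler_sum => l _.
  have /andP[vt0 vt1] := v01 t l.
  rewrite -lerBlDl -mulrBl mderiv_quadraticB ?P_quad//.
  apply: (@le_trans _ _ (2 * (\sum_j quad_coef f (enum_val l) j * r) * 1)).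
    apply: ler_pM => //.
      rewrite mulr_ge0// sumr_ge0// => j _.
      by rewrite mulr_ge0 ?subr_ge0 ?kleene_le_LFP.
    rewrite ler_wpM2l// ler_sum// => j _; rewrite ler_wpM2l//; exact: HM.
  by rewrite mulr1 mulr_suml.
have s3 := vJ t k; rewrite -/f in s3.
have s4 : v t k <= w k + r by have := tw k; rewrite ltr_norml => /andP[]; lra.
have s5 : (C + C' + 1) * r = e by rewrite /r mulrCA mulfV ?mulr1// gt_eqF.
by rewrite -s5; lra.
Qed.

(** Division by the smallest entry, which is positive because all entries are comparable to the
    positive one. *)
Lemma cone_vector : exists v : 'I_m -> R,
  [/\ forall k, 1 <= v k, forall k, v k <= b ^+ m.-1
    & forall k, \sum_l (P (enum_val k))^`M(enum_val l).@[qf] * v l <= v k].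
Proof.
have [w [w0 [k1 wk1] wJ]] := cone_vector_nonneg.
have q0 j : 0 <= q j 0 by exact: ltW.
have b2 := alphaV_ge2 P_MPS q_fix q_gt0 q_le1 (enum_val k0).
have spread i j : w j <= b ^+ m.-1 * w i.
  apply: (@supersolution_spread _ _ e (scc_dep_connect S_scc) b b2
    (fun k l => (P (enum_val k))^`M(enum_val l).@[qf])) => // [k l|k l kl].
    exact: mderiv_ge0.
  apply: (alphaV_edge_ge1 P_MPS P_quad q_fix q_gt0 q_le1 (enum_val k0)) => // j' _.
  by have := q0 j'; lra.
case: (@Order.TotalTheory.arg_minP _ _ _ k0 xpredT w) => // k _ kmin.
have bp : 0 < b ^+ m.-1 by rewrite exprn_gt0// (lt_le_trans _ b2).
have wk : 0 < w k by rewrite -(pmulr_rgt0 _ bp) (lt_le_trans wk1).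
exists (fun l => w l / w k); split=> l.
- by rewrite ler_pdivlMr// mul1r; apply: kmin.
- by rewrite ler_pdivrMr.
under eq_bigr do rewrite mulrA.
by rewrite -mulr_suml ler_pM2r ?invr_gt0.
Qed.

End ConeVector.

(** * One component with approximate lower values *)

Section BlockStep.

Variables (R : realType) (n : nat) (P : system R n) (q : 'cV[R]_n).
Hypotheses (P_MPS : is_MPS P) (P_quad : quadratic P) (q_LFP : is_LFP P q)
  (q_gt0 : forall i, 0 < q i 0) (q_le1 : forall i, q i 0 <= 1).

Local Notation qf := (fun j => q j 0).
Local Notation b := (alpha P q)^-1.
Local Notation N := (norm_oo (eval P (const_mx 1))).

Let q_fix : eval P q = q. Proof. by case: q_LFP. Qed.

Variables (S : {set 'I_n}) (y : 'cV[R]_n) (delta : R).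
Local Notation m := #|S|.
Hypotheses (S_scc : S \in sccs P)
  (y_le : forall j, 0 <= y j 0 <= q j 0)
  (y_close : forall i j, i \in S -> j \notin S -> dep_edge P i j -> q j 0 - y j 0 <= delta)
  (delta_ge0 : 0 <= delta) (delta_le : delta <= alpha P q).

Local Notation Q := (@subsystem R n P S y).
Local Notation qs := (fun k : 'I_m => q (enum_val k) 0).

Let qs_gt0 k : 0 < qs k. Proof. exact: q_gt0. Qed.
Let y_ge0 j : 0 <= y j 0. Proof. by case/andP: (y_le j). Qed.
Let Q_MPS : is_MPS Q. Proof. exact: subsystem_MPS. Qed.
Let Q_quad : quadratic Q. Proof. exact: subsystem_quadratic. Qed.

Let m_gt0 : (0 < m)%N.
Proof. by have /imsetP[i _ ->] := S_scc; rewrite (cardD1 i) mem_scc_of. Qed.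

Let scc_ord : 'I_m := Ordinal m_gt0.

Let b2 : 2 <= b. Proof. exact: (alphaV_ge2 P_MPS q_fix q_gt0 q_le1 (enum_val scc_ord)). Qed.

Lemma block_le j : 0 <= block qs y j <= q j 0.
Proof.
apply: (block_ind (T := fun j r => 0 <= r <= q j 0)) => [k|{}j _]; last exact: y_le.
by rewrite lexx ltW.
Qed.

(** Since [delta <= alpha <= q j / 2], inserted values keep at least half of the true ones. This is
    why edges are tested at [q / 2]. *)
Lemma block_half_le (k : 'I_m) j : dep_edge P (enum_val k) j ->
  q j 0 / 2 <= block (fun k : 'I_m => qs k / 2) y j.
Proof.
apply: (block_ind (T := fun j r => dep_edge P (enum_val k) j -> q j 0 / 2 <= r)) => // {}j jS kj.
have := y_close (enum_valP k) jS kj; have := delta_le.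
by have := alpha_le P q_gt0 j j; lra.
Qed.

Lemma subsystem_edge k l : scc_dep P k l ->
  1 <= b * (Q k)^`M(l).@[fun k => qs k / 2].
Proof.
move=> kl; rewrite mderiv_subsystem//.
apply: (alphaV_edge_ge1 P_MPS P_quad q_fix q_gt0 q_le1 (enum_val k)) => // j.
  by apply: (block_ind (T := fun _ r => 0 <= r)) => // k'; rewrite divr_ge0// ltW.
exact: block_half_le.
Qed.

Lemma subsystem_pert k : (Q k).@[qs] <= qs k <= (Q k).@[qs] + 2 * N * delta.
Proof.
rewrite meval_subsystem; apply/andP; split.
  rewrite -(meval_fix q_fix); apply: (meval_le (P_MPS _) (P_quad _)) => j; by case/andP: (block_le j).
apply: le_trans (meval_perturbation P_MPS P_quad q_fix q_gt0 q_le1 delta_ge0 block_le _) _.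
  move=> j; apply: (block_ind (T := fun j r => dep_edge P (enum_val k) j -> q j 0 - r <= delta)).
    by move=> l _; rewrite subrr.
  by move=> {}j; apply: y_close; exact: enum_valP.
by rewrite lerD2l ler_wpM2r// ler_wpM2l// eval1_le_norm.
Qed.

Lemma subsystem_mderiv_le k l : (Q k)^`M(l).@[qs] <= (P (enum_val k))^`M(enum_val l).@[qf].
Proof.
by rewrite mderiv_subsystem//; apply: mderiv_le => // j; case/andP: (block_le j).
Qed.

(** The error splits through the fixed point [p] of [Q]: [E] bounds [q - p], and the other term
    bounds the distance from [p] to the Newton iterate. *)
Lemma rnm_nonlinear_scc (h g : nat) (E : R) : ~~ linear_scc P q S ->
  4 * N * b ^+ (3 * m) * delta < 1 ->
  0 <= E -> 4 * N * b ^+ (3 * m) * delta <= E ^+ 2 ->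
  exists z : 'cV[R]_m,
    [/\ rnm h Q g = Some z, forall k, 0 <= z k 0 <= qs k
      & forall k, qs k - z k 0 <= E + (2^-1 ^+ g + 2 * 2^-1 ^+ h) * b ^+ m.-1].
Proof.
move=> nlin small E0 dE.
have [k0 [c [d kcd]]] : exists k c d : 'I_m,
    quad_coef (P (enum_val k)) (enum_val c) (enum_val d) != 0.
  have [/existsP[k /existsP[c /existsP[d kcd]]]|H] := boolP [exists k : 'I_m,
    exists c : 'I_m, exists d : 'I_m,
    quad_coef (P (enum_val k)) (enum_val c) (enum_val d) != 0]; first by exists k, c, d.
  case/negP: nlin; apply/(@linear_sccP R n P S P_quad q) => k c d; apply/eqP.
  move/existsPn/(_ k)/existsPn/(_ c)/existsPn/(_ d): H; by rewrite negbK.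
have [v [v1 vb vJ]] := cone_vector P_MPS P_quad q_LFP q_gt0 q_le1 S_scc kcd.
have v0 k : 0 < v k by apply: lt_le_trans (v1 k).
have vQ k : \sum_l (Q k)^`M(l).@[qs] * v l <= v k.
  apply: le_trans (vJ k); apply: ler_sum => l _.
  by rewrite ler_wpM2r ?subsystem_mderiv_le// ltW.
have [||p [pq Qp _ _]] := kleene_limit Q_MPS Q_quad (q := qs).
- by move=> k; exact: ltW.
- by move=> k; case/andP: (subsystem_pert k).
have bq : 1 <= b * quad_coef (Q k0) c d.
  rewrite quad_coef_subsystem//.
  exact: (alphaV_quad_coef_ge1 P_MPS q_fix q_gt0 q_le1 (enum_val k0)).
have N0 : 0 <= N.
  apply: le_trans (norm_eval1_ge P_MPS P_quad q_fix q_gt0 q_le1 (enum_val k0)).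
  by rewrite mulr_ge0// ltW// (alpha_gt0 P_MPS q_fix q_gt0 (enum_val k0)).
have b0 : 0 < b := lt_le_trans (ltr0n _ 2) b2.
have m0 : (0 < m)%N := leq_ltn_trans (leq0n k0) (ltn_ord k0).
(* The perturbation bound leaves a factor [b ^+ 2] to spare. With it [q - p < alpha <= q / 2], so
   [p] is positive, as the Newton iteration requires. *)
have pert k : b ^+ 2 * (qs k - p k) ^+ 2 <= 4 * N * b ^+ (3 * m) * delta.
  have := fixpoint_perturbation Q_MPS Q_quad (scc_dep_connect S_scc) b2 qs_gt0
    subsystem_edge v0 vQ pq Qp subsystem_pert bq k.
  move=> /(ler_wpM2l (exprn_ge0 2 (ltW b0)))/le_trans; apply.
  have -> : (3 * m = 2 + (3 * m.-1 + 1))%N by lia.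
  rewrite (exprD b 2) le_eqVlt; apply/orP; left; apply/eqP.
  by move: (b ^+ 2) (b ^+ (3 * m.-1 + 1)) => u w; ring.
have qp k : 0 <= qs k - p k by rewrite subr_ge0; case/andP: (pq k).
have p0 k : 0 < p k.
  have lt1 : (b * (qs k - p k)) ^+ 2 < 1 by rewrite exprMn; apply: le_lt_trans (pert k) small.
  have : b * (qs k - p k) < 1.
    by rewrite -(@ltr_pXn2r _ 2) ?expr1n// nnegrE ?mulr_ge0// ltW.
  rewrite mulrC ltr_pdivrMr ?mul1r; last exact: (alpha_gt0 P_MPS q_fix q_gt0 (enum_val k0)).
  by have := alpha_le P q_gt0 (enum_val k0) (enum_val k); have := qs_gt0 k; lra.
have p01 k : 0 < p k <= 1.
  by rewrite p0 (le_trans _ (q_le1 (enum_val k)))//; case/andP: (pq k).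
have edge k l : scc_dep P k l -> 0 < (Q k)^`M(l).@[fun k => qs k / 2].
  by move=> kl; rewrite -(pmulr_rgt0 _ b0) (lt_le_trans ltr01) ?subsystem_edge.
have nl : 0 < quad_coef (Q k0) c d by rewrite -(pmulr_rgt0 _ b0) (lt_le_trans ltr01).
have vp k : \sum_l (Q k)^`M(l).@[p] * v l <= v k.
  apply: le_trans (vQ k); apply: ler_sum => l _; rewrite ler_wpM2r ?(ltW (v0 l))//.
  by apply: mderiv_le => // j; case/andP: (pq j).
have [z [Ez zp zv]] := rnm_nonlinear Q_MPS Q_quad (scc_dep_connect S_scc) edge nl Qp v0 vp h g p01 v1.
exists z; split=> // k.
  have /andP[-> zk] := zp k; have /andP[_ pk] := pq k.
  exact: le_trans (ltW zk) pk.
have pE : qs k - p k <= E.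
  rewrite -(@ler_pXn2r _ 2) ?nnegrE//; apply: le_trans dE; apply: le_trans (pert k).
  by rewrite ler_peMl ?exprn_ge0// exprn_ege1// (le_trans _ b2)// ler1n.
have zb : (2^-1 ^+ g + 2 * 2^-1 ^+ h) * v k <= (2^-1 ^+ g + 2 * 2^-1 ^+ h) * b ^+ m.-1.
  by rewrite ler_wpM2l// addr_ge0 ?mulr_ge0// exprn_ge0// invr_ge0.
by have := zv k; lra.
Qed.

(** By linearity the slack equals [P] at [w], which is 0 on [S] and [q] elsewhere. Were it zero in
    all rows, the Kleene iterates would vanish on [S] and could not converge to [q]. The smallest
    case is an off-diagonal product, whose weight 1/2 turns [4 * alpha ^+ 2] into
    [2 * alpha ^+ 2]. *)
Lemma linear_scc_strict : linear_scc P q S -> exists k : 'I_m,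
  2 * alpha P q ^+ 2 <= qs k - \sum_l (P (enum_val k))^`M(enum_val l).@[qf] * qs l.
Proof.
move=> lin; pose w : 'I_n -> R := block (fun k : 'I_m => 0) q.
pose scc_i := enum_val scc_ord.
have a0 := alpha_gt0 P_MPS q_fix q_gt0 scc_i.
have w0 j : 0 <= w j by apply: (block_ind (T := fun _ r => 0 <= r)) => // k _; exact: ltW.
have wq j : w j = 0 \/ w j = q j 0.
  by apply: (block_ind (T := fun j r => r = 0 \/ r = q j 0)); [left|right].
have FE k : qs k - \sum_l (P (enum_val k))^`M(enum_val l).@[qf] * qs l
    = (P (enum_val k)).@[w].
  have Fq : quadratic (@subsystem R n P S q) by apply: subsystem_quadratic.
  have := taylor_quadratic (fun=> 0) qs (Fq k).
  rewrite !meval_subsystem -/w => ->.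
  have bq : block qs q =1 qf by apply: (block_ind (T := fun j r => r = q j 0)).
  rewrite (meval_eq _ bq) (meval_fix q_fix) -addrA; congr (_ + _).
  rewrite [X in _ + X]big1 ?addr0; last first.
    move=> c _; rewrite big1// => d _; rewrite quad_coef_subsystem//.
    by move/(@linear_sccP R n P S P_quad q) : lin => ->; rewrite mul0r.
  rewrite -sumrN; apply: eq_bigr => l _.
  by rewrite mderiv_subsystem// (meval_eq _ bq) sub0r mulrN.
have [/existsP[k wk]|wn] := boolP [exists k : 'I_m, (P (enum_val k)).@[w] != 0]; last first.
  exfalso.
  have K t (k : 'I_m) : kleene P t (enum_val k) = 0.
    elim: t k => // t IH k; apply/eqP; rewrite eq_le kleene_ge0// andbT.
    move/existsPn/(_ k): wn; rewrite negbK => /eqP <-.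
    apply: meval_le => // [j|j]; first exact: kleene_ge0.
    apply: (block_ind (T := fun j r => kleene P t j <= r)) => [l|{}j _]; first by rewrite IH.
    exact: kleene_le_LFP.
  have q2 : 0 < qs scc_ord / 2 by rewrite divr_gt0.
  have [M /(_ M (enum_val scc_ord) (leqnn M))] := kleene_LFP_cvg P_MPS P_quad q_LFP q_gt0 q2.
  by rewrite K; have := qs_gt0 scc_ord; lra.
exists k; rewrite FE.
pose f := P (enum_val k).
have f0 mm : 0 <= f@_mm by apply: P_MPS.
have sf : (msize f <= 3)%N by apply: P_quad.
have fw : f.@[w] != 0 by [].
have a_le1 : 2 * alpha P q <= 1.
  by have := alpha_le P q_gt0 scc_i scc_i; have := q_le1 scc_i; lra.
have aq j : 2 * alpha P q <= q j 0 by have := alpha_le P q_gt0 scc_i j; lra.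
have qm1 : qmin q <= 1 by apply: le_trans (qmin_le _ scc_i) (q_le1 _).
(* One bound for all degrees: missing variables of a monomial are filled in by 1. *)
have co mm (x z : R) : f@_mm != 0 -> qmin q <= x -> 2 * alpha P q <= z ->
    4 * alpha P q ^+ 2 <= f@_mm * (x * z).
  move=> fm qx az.
  have := alpha_le_coef P_MPS q_fix q_gt0 scc_i (x := x / 2) fm.
  move=> /(_ (ler_wpM2r _ qx)) ax.
  have {}ax : 2 * alpha P q <= f@_mm * x by have := ax; rewrite invr_ge0 ler0n => /(_ isT); lra.
  have -> : 4 * alpha P q ^+ 2 = (2 * alpha P q) * (2 * alpha P q) by ring.
  by rewrite [leRHS]mulrA; apply: ler_pM => //; rewrite mulr_ge0// ltW.
have a20 : 0 <= alpha P q ^+ 2 by rewrite exprn_ge0// ltW.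
have L0 : 0 <= \sum_j f@_U_(j) * w j by rewrite sumr_ge0// => j _; rewrite mulr_ge0.
have H0 : 0 <= quad_part f w w by apply: quad_part_ge0.
have c00 := f0 0%MM.
have fE := meval_quadratic w sf.
have [c0|c0] := eqVneq f@_0 0; last first.
  by have := co _ 1 1 c0 qm1 a_le1; rewrite -/f fE; lra.
have [/existsP[j Lj]|Ln] := boolP [exists j, f@_U_(j) * w j != 0].
  have : f@_U_(j) * w j <= \sum_j f@_U_(j) * w j.
    by rewrite (bigD1 j)//= lerDl sumr_ge0// => l _; rewrite mulr_ge0.
  move: Lj; rewrite mulf_eq0 negb_or => /andP[Lj wj].
  have wjq : w j = q j 0 by case: (wq j) => // E; rewrite E eqxx in wj.
  rewrite wjq; have := co _ (q j 0) 1 Lj (qmin_le _ j) a_le1.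
  by rewrite -/f fE; lra.
have LE : \sum_j f@_U_(j) * w j = 0.
  by apply: big1 => j _; apply/eqP; move/existsPn/(_ j): Ln; rewrite negbK.
have [/existsP[j /existsP[l Hjl]]|Hn] :=
  boolP [exists j, exists l, quad_coef f j l * (w j * w l) != 0]; last first.
  case/negP: fw; rewrite fE c0 LE !add0r; apply/eqP; apply: big1 => j _; apply: big1 => l _.
  by apply/eqP; move/existsPn/(_ j)/existsPn/(_ l): Hn; rewrite negbK.
have := quad_part_ge f0 j l w0 w0; move: Hjl.
rewrite mulf_eq0 negb_or => /andP[cjl]; rewrite mulf_eq0 negb_or => /andP[wj wl].
have wjq : w j = q j 0 by case: (wq j) => // E; rewrite E eqxx in wj.
have wlq : w l = q l 0 by case: (wq l) => // E; rewrite E eqxx in wl.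
have fjl : f@_(U_(j) + U_(l)) != 0 by move: cjl; rewrite /quad_coef mulf_eq0 negb_or => /andP[].
rewrite wjq wlq; have := co _ _ _ fjl (qmin_le _ j) (aq l).
have : 2^-1 * (f@_(U_(j) + U_(l)) * (q j 0 * q l 0)) <= quad_coef f j l * (q j 0 * q l 0).
  rewrite [leLHS]mulrA ler_wpM2r ?mulr_ge0 ?(ltW (q_gt0 _))// [leLHS]mulrC ler_wpM2l//.
  exact: quad_coef_weight.
by rewrite -/f fE; lra.
Qed.

(** Here [eta = 2 N delta], and dividing by [rho = 2 * alpha ^+ 2] raises the exponent [m.-1] to
    [m.+1]. *)
Lemma rnm_linear_scc (h : nat) : linear_scc P q S ->
  exists z : 'cV[R]_m,
    [/\ rnm h Q 1 = Some z, forall k, 0 <= z k 0 <= qs k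
      & forall k, qs k - z k 0 <= 2 * N * b ^+ m.+1 * delta + 2^-1 ^+ h].
Proof.
move=> lin; have [k0 strict] := linear_scc_strict lin.
have a0 := alpha_gt0 P_MPS q_fix q_gt0 (enum_val scc_ord).
have b0 : 0 < b := lt_le_trans (ltr0n _ 2) b2.
have edge k l : scc_dep P k l -> 1 <= b * (Q k)^`M(l).@[qs].
  move=> kl; apply: le_trans (subsystem_edge kl) _; rewrite ler_wpM2l ?(ltW b0)//.
  by apply: mderiv_le => // j; have := qs_gt0 j; lra.
have Qlin k c d : quad_coef (Q k) c d = 0.
  by rewrite quad_coef_subsystem//; move/(@linear_sccP R n P S P_quad q): lin.
have q01 k : 0 < qs k <= 1 by rewrite q_gt0 q_le1.
have rho0 : 0 < 2 * alpha P q ^+ 2 by rewrite mulr_gt0// exprn_gt0.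
have st : 2 * alpha P q ^+ 2 <= qs k0 - \sum_l (Q k0)^`M(l).@[qs] * qs l.
  apply: le_trans strict _; rewrite lerD2l lerN2; apply: ler_sum => l _.
  by rewrite ler_wpM2r ?subsystem_mderiv_le// ltW.
have [z [Ez zq zb]] := rnm_linear Q_MPS Q_quad (scc_dep_connect S_scc) b2 edge Qlin q01
  subsystem_pert rho0 st h.
exists z; split=> // k; rewrite -lerBlDr.
have := zb k; rewrite -ler_pdivlMr// => /le_trans; apply.
have -> : m.+1 = (m.-1 + 2)%N by have := m_gt0; lia.
rewrite exprD exprVn le_eqVlt; apply/orP; left; apply/eqP; field.
by rewrite !gt_eqF ?exprn_gt0.
Qed.

End BlockStep.

(** * Maximal counts on paths from a component *)

Section MaxFrom.

Variables (R : realType) (n : nat) (P : system R n) (a : pred {set 'I_n}).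
Implicit Types S T : {set 'I_n}.

(** The exponents [d'] and [f'], obtained for [predT] and for the nonlinear components. *)
Definition max_from S : nat :=
  \max_(k < n.+1) \max_(t : k.-tuple {set 'I_n} | scc_path P (S :: t)) count a (S :: t).

Lemma le_max_from S t : scc_path P (S :: t) -> (count a (S :: t) <= max_from S)%N.
Proof.
move=> pt; have st : (size t < n.+1)%N by rewrite ltnS ltnW// (size_scc_path pt).
apply: leq_trans (leq_bigmax (Ordinal st)).
exact: (leq_bigmax_cond (in_tuple t)).
Qed.

Lemma max_from_le S c :
  (forall t, scc_path P (S :: t) -> (count a (S :: t) <= c)%N) -> (max_from S <= c)%N.
Proof.
move=> H; apply/bigmax_leqP => k _; apply/bigmax_leqP => t; exact: H.
Qed.

Lemma max_from_ge S : S \in sccs P -> (a S <= max_from S)%N.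
Proof.
move=> SP; have := @le_max_from S [::]; rewrite /scc_path /= addn0 SP; exact.
Qed.

Lemma max_from_edge S T : S \in sccs P -> scc_edge P S T ->
  (a S + max_from T <= max_from S)%N.
Proof.
move=> SP ST; rewrite -leq_subRL ?max_from_ge//; apply: max_from_le => t pt.
rewrite leq_subRL ?max_from_ge//; apply: (@le_max_from S (T :: t)).
by move: pt; rewrite /scc_path /= SP ST.
Qed.

Lemma max_from_le_max S : (max_from S <= max_on_scc_paths P a)%N.
Proof.
apply: max_from_le => t pt; have st : (size (S :: t) < n.+1)%N.
  by rewrite ltnS (size_scc_path pt).
apply: leq_trans (leq_bigmax (Ordinal st)).
exact: (leq_bigmax_cond (in_tuple (S :: t))).
Qed.

End MaxFrom.

(** Exponentiating the bound on [h]: the summand 3 becomes the factor 8, and the factor [2 ^+ f]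
    becomes an exponent. *)
Lemma log2_bound (R : realType) (h d f : nat) (eps A B C : R) :
  0 < eps -> 0 < A -> 0 < B -> 0 < C ->
  Num.ceil (3 + 2 ^+ f * (log2 (1 / eps) + d%:R * (log2 A + log2 B + log2 C))) <= h%:Z ->
  2^-1 ^+ h <= (eps / (A * B * C) ^+ d) ^+ (2 ^ f) / 8.
Proof.
move=> e0 A0 B0 C0 hc; set K := A * B * C.
have K0 : 0 < K by rewrite !mulr_gt0.
have l2 : 0 < exp.ln (2 : R) by rewrite exp.ln_gt0// ltr1n.
pose b := eps / K ^+ d.
have b0 : 0 < b by rewrite divr_gt0// exprn_gt0.
have bi0 : 0 < b^-1 by rewrite invr_gt0.
have xh : 3 + 2 ^+ f * (log2 (1 / eps) + d%:R * (log2 A + log2 B + log2 C)) <= h%:R :> R.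
  apply: le_trans (Num.Theory.ceil_ge _) _.
  by rewrite -[h%:R]/(h%:Z%:~R) ler_int.
have lnb : exp.ln b^-1 = exp.ln (1 / eps) + d%:R * (exp.ln A + exp.ln B + exp.ln C).
  rewrite /b invfM invrK mul1r exp.lnM ?posrE ?invr_gt0 ?exprn_gt0//.
  by rewrite exp.lnXn// /K !exp.lnM ?posrE ?mulr_gt0// mulr_natl.
have lnX (x : R) k : 0 < x -> exp.ln (x ^+ k) = k%:R * exp.ln x.
  by move=> x0; rewrite exp.lnXn// mulr_natl.
have E : exp.ln (8 * b^-1 ^+ (2 ^ f)) <= exp.ln (2 ^+ h).
  have -> : (8 : R) = 2 ^+ 3 by ring.
  rewrite exp.lnM ?posrE ?exprn_gt0// !lnX// natrX lnb.
  rewrite -ler_pdivrMr//; apply: le_trans xh.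
  rewrite /log2 le_eqVlt; apply/orP; left; apply/eqP; field.
  by rewrite gt_eqF.
have p8 : 0 < 8 * b^-1 ^+ (2 ^ f) by rewrite mulr_gt0// exprn_gt0.
move: E; rewrite exp.ler_ln ?posrE ?exprn_gt0// => E.
rewrite -/b exprVn -[leRHS]invrK lef_pV2 ?posrE ?exprn_gt0 ?invr_gt0 ?divr_gt0 ?exprn_gt0//.
by rewrite invfM invrK mulrC -exprVn.
Qed.

(** * The gain and the error of one component *)

Section Convergence.

Variables (R : realType) (n : nat) (P : system R n) (q : 'cV[R]_n).
Hypotheses (P_MPS : is_MPS P) (P_quad : quadratic P) (q_LFP : is_LFP P q)
  (q_gt0 : forall i, 0 < q i 0) (q_le1 : forall i, q i 0 <= 1).

Local Notation b := (alpha P q)^-1.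
Local Notation N := (norm_oo (eval P (const_mx 1))).

Let q_fix : eval P q = q. Proof. by case: q_LFP. Qed.

Definition gain : R := alpha P q ^- (4 * n + 1) * (16 * n)%:R * N.
Local Notation K := gain.

Section GainBounds.

Variable i0 : 'I_n.

Let b2 : 2 <= b. Proof. exact: (alphaV_ge2 P_MPS q_fix q_gt0 q_le1 i0). Qed.
Let b1 : 1 <= b. Proof. by apply: le_trans b2; rewrite ler1n. Qed.
Let b0 : 0 < b. Proof. by apply: lt_le_trans b2. Qed.
Let n_ge1 : 1 <= n%:R :> R. Proof. by rewrite ler1n (leq_ltn_trans _ (ltn_ord i0)). Qed.

Lemma alphaV_norm_ge2 : 2 <= b * N.
Proof.
have := norm_eval1_ge P_MPS P_quad q_fix q_gt0 q_le1 i0.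
move/(ler_wpM2l (ltW b0)); apply: le_trans.
rewrite mulrCA mulVf ?mulr1// gt_eqF//.
exact: (alpha_gt0 P_MPS q_fix q_gt0 i0).
Qed.

Lemma norm_eval1_gt0 : 0 < N.
Proof. by rewrite -(pmulr_rgt0 _ b0) (lt_le_trans _ alphaV_norm_ge2). Qed.

Lemma gain_ge_norm m : (m <= n)%N -> 16 * N * b ^+ (3 * m) <= K.
Proof.
move=> mn; have N0 := norm_eval1_gt0.
rewrite /gain -exprVn natrM.
have bm : b ^+ (3 * m) <= b ^+ (4 * n + 1) by rewrite ler_weXn2l//; lia.
have t : 1 * b ^+ (3 * m) <= n%:R * b ^+ (4 * n + 1).
  by apply: ler_pM => //; rewrite exprn_ge0// ltW.
by have := ler_wpM2l (ltW N0) t; lra.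
Qed.

(** The extra 1 in the exponent [4 * n + 1] provides [b * N >= 2], which absorbs a small norm. *)
Lemma gain_ge_pow m : (m <= n)%N -> b ^+ m <= K.
Proof.
move=> mn; rewrite /gain -exprVn natrM addn1 exprS.
have bm : b ^+ m <= b ^+ (4 * n) by rewrite ler_weXn2l//; lia.
have B0 : 0 <= b ^+ (4 * n) by rewrite exprn_ge0// ltW.
have t : 2 * 1 <= (b * N) * n%:R by apply: ler_pM => //; exact: alphaV_norm_ge2.
by have := ler_wpM2l B0 t; lra.
Qed.

Lemma gain_ge_alphaV : b <= K.
Proof.
by rewrite -[b]expr1; apply: gain_ge_pow; apply: leq_ltn_trans (ltn_ord i0).
Qed.

Lemma gain_ge1 : 1 <= K.
Proof. by apply: le_trans gain_ge_alphaV. Qed.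

End GainBounds.

(** A component costs one factor [K], and a nonlinear one also a square root of [Y ^+ 2]. In that
    case half of the target bounds the shift of the fixed point and half the iteration, where
    [2^-g + 2 * 2^-h <= 4 * 2^-h <= Y / 2]. *)
Lemma rnm_scc (S : {set 'I_n}) (y : 'cV[R]_n) (h g d : nat) (Y : R) :
  S \in sccs P -> (forall j, 0 <= y j 0 <= q j 0) ->
  (forall i j, i \in S -> j \notin S -> dep_edge P i j ->
    q j 0 - y j 0 <= K ^+ d * (if linear_scc P q S then Y else Y ^+ 2)) ->
  0 < Y -> K ^+ d.+1 * Y <= 1 -> 2^-1 ^+ h <= Y / 8 -> (h - 1 <= g)%N ->
  exists z : 'cV[R]_#|S|,
    [/\ rnm h (@subsystem R n P S y) (if linear_scc P q S then 1 else g) = Some z,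
        forall k, 0 <= z k 0 <= q (enum_val k) 0
      & forall k, q (enum_val k) 0 - z k 0 <= K ^+ d.+1 * Y].
Proof.
have m3 m : (0 < m)%N -> (m.+1 <= 3 * m)%N by lia.
move=> SP yq yc Y0 KY hY hg.
have /imsetP[i _ Si] := SP.
have m0 : (0 < #|S|)%N by rewrite Si (cardD1 i) mem_scc_of.
have mn : (#|S| <= n)%N by rewrite -[leqRHS]card_ord max_card.
have K1 := gain_ge1 i; have Kb := gain_ge_alphaV i.
have KN := gain_ge_norm i mn; have Km := gain_ge_pow i mn.
have K0 : 0 < K by apply: lt_le_trans K1.
have Kd1 : 1 <= K ^+ d by rewrite exprn_ege1.
have N0 := norm_eval1_gt0 i.
have a0 := alpha_gt0 P_MPS q_fix q_gt0 i.
have b2 := alphaV_ge2 P_MPS q_fix q_gt0 q_le1 i.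
have b1 : 1 <= b by apply: le_trans b2; rewrite ler1n.
have Y1 : Y <= 1.
  by apply: le_trans KY; rewrite ler_peMl ?(ltW Y0)// exprn_ege1.
(* As [K >= b], whatever one factor [K] keeps below 1 is at most [alpha]. *)
have d_le (x : R) : K * x <= 1 -> 0 <= x -> x <= alpha P q.
  move=> Kx x0; have := le_trans (ler_wpM2r x0 Kb) Kx.
  by move/(ler_wpM2l (ltW a0)); rewrite mulrA mulfV ?gt_eqF// mul1r mulr1.
case: ifP => lin; rewrite lin in yc.
  have dle : K ^+ d * Y <= alpha P q.
    by apply: d_le; rewrite ?mulrA -?exprS// mulr_ge0 ?exprn_ge0 ?ltW.
  have d0 : 0 <= K ^+ d * Y by rewrite mulr_ge0 ?exprn_ge0 ?ltW.
  have [z [Ez zq zb]] := rnm_linear_scc P_MPS P_quad q_LFP q_gt0 q_le1 SP yq yc d0 dle h lin.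
  exists z; split=> // k; apply: le_trans (zb k) _.
  have bm : b ^+ #|S|.+1 <= b ^+ (3 * #|S|) by apply: ler_weXn2l => //; exact: m3.
  have t1 : 4 * N * b ^+ #|S|.+1 <= K.
    apply: le_trans KN; apply: ler_pM => //; rewrite ?mulr_ge0 ?exprn_ge0 ?(ltW N0) ?invr_ge0 ?(ltW a0)//.
    by rewrite ler_wpM2r ?(ltW N0)// ler_nat.
  have := ler_wpM2r d0 t1; have := ler_wpM2r d0 K1; have := ler_wpM2r (ltW Y0) Kd1.
  rewrite (exprS K) -(mulrA K); move: (K ^+ d * Y) (b ^+ #|S|.+1) (2^-1 ^+ h) hY Y0 => D B r.
  by lra.
have dle : K ^+ d * Y ^+ 2 <= alpha P q.
  apply: d_le; last by rewrite mulr_ge0 ?exprn_ge0 ?ltW.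
  by rewrite expr2 !mulrA -exprS -[leRHS]mulr1 ler_pM ?mulr_ge0 ?exprn_ge0 ?(ltW Y0) ?(ltW K0).
have d0 : 0 <= K ^+ d * Y ^+ 2 by rewrite mulr_ge0 ?exprn_ge0 ?ltW.
have B0 : 0 <= b ^+ (3 * #|S|) by rewrite exprn_ge0// (le_trans _ b1).
have small : 4 * N * b ^+ (3 * #|S|) * (K ^+ d * Y ^+ 2) < 1.
  have t : K * (K ^+ d * Y ^+ 2) <= 1.
    by rewrite expr2 !mulrA -exprS -[leRHS]mulr1 ler_pM ?mulr_ge0 ?exprn_ge0 ?(ltW Y0) ?(ltW K0).
  by have := ler_wpM2r d0 KN; lra.
have E0 : 0 <= K ^+ d.+1 * Y / 2 by rewrite divr_ge0// mulr_ge0 ?exprn_ge0 ?ltW.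
have dE : 4 * N * b ^+ (3 * #|S|) * (K ^+ d * Y ^+ 2) <= (K ^+ d.+1 * Y / 2) ^+ 2.
  have -> : (K ^+ d.+1 * Y / 2) ^+ 2 = K ^+ d * K / 4 * (K * (K ^+ d * Y ^+ 2)).
    by rewrite (exprS K d); field.
  have t1 : 4 * N * b ^+ (3 * #|S|) <= K / 4 by lra.
  apply: le_trans (ler_wpM2r d0 t1) _.
  have KK : 1 <= K ^+ d * K by rewrite -exprSr exprn_ege1.
  have := ler_wpM2r (mulr_ge0 (ltW K0) d0) KK; lra.
have [z [Ez zq zb]] := rnm_nonlinear_scc P_MPS P_quad q_LFP q_gt0 q_le1 SP yq yc d0 dle
  h g (negbT lin) small E0 dE.
exists z; split=> // k; apply: le_trans (zb k) _.
(* The truncated [h - 1] is 0 for [h = 0], which is treated apart. *)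
have hg2 : 2^-1 ^+ g <= 2 * 2^-1 ^+ h :> R.
  have [h0|h0] := posnP h.
    have : 2^-1 ^+ g <= 1 :> R by apply: exprn_ile1; lra.
    by rewrite h0 expr0; lra.
  rewrite -(prednK h0) exprS mulrA mulfV ?mul1r// ?pnatr_eq0//.
  by rewrite subn1 in hg; rewrite ler_wiXn2l//; lra.
have t2 : b ^+ #|S|.-1 <= K ^+ d.+1.
  apply: (@le_trans _ _ K); first by apply: le_trans Km; rewrite ler_weXn2l// leq_pred.
  by rewrite exprS ler_peMr// ltW.
have c0 : 0 <= 2^-1 ^+ g + 2 * 2^-1 ^+ h :> R.
  by rewrite addr_ge0 ?mulr_ge0// exprn_ge0// invr_ge0.
have := ler_wpM2l c0 t2.
have Kd0 : 0 <= K ^+ d.+1 by rewrite exprn_ge0// ltW.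
have t3 : 2^-1 ^+ g + 2 * 2^-1 ^+ h <= Y / 2 by lra.
have := ler_wpM2r Kd0 t3; lra.
Qed.

End Convergence.

(** * Error propagation along a bottom-up run *)

Section Decomposed.

Variables (R : realType) (n : nat) (P : system R n) (q : 'cV[R]_n).
Hypotheses (P_MPS : is_MPS P) (P_quad : quadratic P) (q_LFP : is_LFP P q)
  (q_gt0 : forall i, 0 < q i 0) (q_le1 : forall i, q i 0 <= 1).
Variables (eps : R) (h g : nat) (s : seq {set 'I_n}).

Local Notation K := (gain P q).
Local Notation nonlinear := (fun S => ~~ linear_scc P q S).
Local Notation f := (nonlinear_depth P q).
Local Notation beta := (eps / K ^+ depth P).

Hypotheses (eps_gt0 : 0 < eps) (eps_lt1 : eps < 1) (K_ge1 : 1 <= K)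
  (h_ge : 2^-1 ^+ h <= beta ^+ (2 ^ f) / 8)
  (g_ge : (h - 1 <= g)%N) (s_bottom_up : bottom_up P s).

Definition level (S : {set 'I_n}) : R := beta ^+ (2 ^ (f - max_from P nonlinear S)).

Definition error (S : {set 'I_n}) : R := K ^+ max_from P predT S * level S.

Let K_gt0 : 0 < K. Proof. exact: lt_le_trans K_ge1. Qed.

Let beta_gt0 : 0 < beta. Proof. by rewrite divr_gt0// exprn_gt0. Qed.

Let beta_le1 : beta <= 1.
Proof.
rewrite ler_pdivrMr ?exprn_gt0// mul1r (le_trans (ltW eps_lt1))//.
by rewrite exprn_ege1.
Qed.

Lemma error_le S : error S <= eps.
Proof.
have -> : eps = K ^+ depth P * beta by rewrite mulrCA mulfV ?mulr1// gt_eqF ?exprn_gt0.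
rewrite /error /level; apply: ler_pM; rewrite ?exprn_ge0 ?(ltW K_gt0) ?(ltW beta_gt0)//.
  by rewrite ler_weXn2l// max_from_le_max.
by rewrite -[leRHS]expr1 ler_wiXn2l ?(ltW beta_gt0)// expn_gt0.
Qed.

(** An edge lowers [d'] by at least 1. If [S] is nonlinear it also lowers [f'], and the doubled
    exponent of [beta] is the square of [level S]. *)
Lemma error_edge S T : S \in sccs P -> scc_edge P S T ->
  error T <= K ^+ (max_from P predT S).-1 *
    (if linear_scc P q S then level S else level S ^+ 2).
Proof.
move=> SP ST; rewrite /error; apply: ler_pM; rewrite ?exprn_ge0 ?(ltW K_gt0) ?(ltW beta_gt0)//.
  by rewrite ler_weXn2l//; have := max_from_edge predT SP ST; rewrite /=; lia.
have := max_from_edge nonlinear SP ST; have := max_from_le_max P nonlinear S.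
rewrite -/(nonlinear_depth P q) /level; case: ifP => _ /=; rewrite -?exprM ?addn1 -?expnSr => le1 le2.
  by rewrite ler_wiXn2l ?(ltW beta_gt0)// leq_exp2l//; lia.
by rewrite ler_wiXn2l ?(ltW beta_gt0)// leq_exp2l//; lia.
Qed.

(** The loop invariant after the components in [s1]; the bounds by 0 and [q] also cover coordinates
    not yet computed. *)
Definition approximates (s1 : seq {set 'I_n}) (y : 'cV[R]_n) :=
  (forall j, 0 <= y j 0 <= q j 0) /\
  (forall S j, S \in s1 -> j \in S -> q j 0 - y j 0 <= error S).

Lemma rdnm_step s1 S s2 y : s = s1 ++ S :: s2 -> approximates s1 y ->
  exists2 y' : 'cV[R]_n, rdnm_scc P q h g y S = Some y' & approximates (rcons s1 S) y'.
Proof.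
move=> sE [yq y1]; have [ps bu] := s_bottom_up.
have us : uniq s by rewrite (perm_uniq ps) enum_uniq.
have ms T : (T \in s) = (T \in sccs P) by rewrite (perm_mem ps) mem_enum.
have Ss : S \in s by rewrite sE mem_cat mem_head orbT.
have SP : S \in sccs P by rewrite -ms.
have S1 : S \notin s1.
  by move: us; rewrite sE cat_uniq => /and3P[_ /hasPn/(_ S)]; rewrite mem_head; move/(_ isT).
have D1 := max_from_ge predT SP; rewrite /= in D1.
have Y0 : 0 < level S by rewrite exprn_gt0.
have yc i j : i \in S -> j \notin S -> dep_edge P i j ->
    q j 0 - y j 0 <= K ^+ (max_from P predT S).-1 *
      (if linear_scc P q S then level S else level S ^+ 2).
  move=> iS jS ij; have ST := scc_edge_out iS jS ij.
  apply: le_trans (error_edge SP ST); apply: y1 (mem_scc_of P j).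
  have Ts : scc_of P j \in s by rewrite ms scc_of_in_sccs.
  (* [S] stands right after [s1], so a component of smaller index belongs to [s1]. *)
  have := bu _ _ Ss Ts ST; rewrite sE !index_cat (negbTE S1) /= eqxx addn0.
  by case: ifP => // _; rewrite ltnNge leq_addr.
have KY : K ^+ (max_from P predT S).-1.+1 * level S <= 1.
  by rewrite prednK//; apply: le_trans (error_le S) (ltW eps_lt1).
have hY : 2^-1 ^+ h <= level S / 8.
  apply: le_trans h_ge _; rewrite ler_wpM2r ?invr_ge0// ler_wiXn2l ?(ltW beta_gt0)//.
  by rewrite leq_exp2l// leq_subr.
have [z [Ez zq zb]] := rnm_scc P_MPS P_quad q_LFP q_gt0 q_le1 SP yq yc Y0 KY hY g_ge.
exists (set_block z y); first by rewrite /rdnm_scc Ez.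
have bE j : set_block z y j 0 = block (fun k => z k 0) y j by rewrite mxE.
split=> [j|T j].
  rewrite bE; apply: (block_ind (T := fun j r => 0 <= r <= q j 0)) => // k.
rewrite mem_rcons inE => /predU1P[->|T1] jT.
  rewrite bE -(enum_rankK_in jT jT) block_in; apply: le_trans (zb _) _.
  by rewrite /error prednK.
have TP : T \in sccs P by rewrite -ms sE mem_cat T1.
rewrite bE block_notin; first exact: y1.
(* Distinct components are disjoint, so writing the block of [S] preserves earlier ones. *)
apply: contra S1 => jS.
by rewrite -(scc_of_mem SP jS) (scc_of_mem TP jT).
Qed.

Lemma rdnm_approximates : exists2 qt, rdnm P q h g s = Some qt & approximates s qt.
Proof.
suff H s2 s1 y : s = s1 ++ s2 -> approximates s1 y ->
    exists2 qt, foldl (fun oy S => obind (fun y => rdnm_scc P q h g y S) oy) (Some y) s2 = Some qt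
      & approximates s qt.
  apply: (H s [::]) => //; split=> // j; by rewrite mxE lexx ltW.
elim: s2 s1 y => [|S s2 IH] s1 y sE ay; first by exists y; rewrite // sE cats0.
have [y' Ey' ay'] := rdnm_step sE ay; rewrite /= Ey'.
by apply: IH ay'; rewrite cat_rcons.
Qed.

End Decomposed.

(** * Accuracy of the decomposed method *)

Theorem theorem3 (R : realType) (n : nat) (P : system R n) (q : 'cV[R]_n)
    (eps : R) (h g : nat) (s : seq {set 'I_n})
    (eps_gt0 : 0 < eps) (eps_lt1 : eps < 1)
    (P_MPS : is_MPS P) (P_quadratic : quadratic P)
    (q_LFP : is_LFP P q)
    (q_gt0 : forall i, 0 < q i 0) (q_le1 : forall i, q i 0 <= 1)
    (h_ge : Num.ceil (3 + 2 ^+ nonlinear_depth P q *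
        (log2 (1 / eps) + (depth P)%:R *
          (log2 (alpha P q ^- (4 * n + 1)) + log2 (16 * n)%:R
           + log2 (norm_oo (eval P (const_mx 1)))))) <= h%:Z)
    (g_ge : (h - 1 <= g)%N)
    (s_bottom_up : bottom_up P s) :
  exists qt : 'cV[R]_n,
    [/\ rdnm P q h g s = Some qt,
        forall i, qt i 0 <= q i 0
      & norm_oo (q - qt) <= eps].
Proof.
have [ps _] := s_bottom_up.
(* For [n = 0] there is no component and the claim is trivial; the bounds on [alpha] and the gain
   require an index. *)
have [/existsP[i0 _]|no_i] := boolP [exists i : 'I_n, true]; last first.
  have no (i : 'I_n) : False by move/existsPn/(_ i): no_i.
  have s0 : s = [::].
    apply/perm_nilP; apply: perm_trans ps _; rewrite perm_sym.
    case E : (enum _) => [|S t] //.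
    have : S \in enum (sccs P) by rewrite E mem_head.
    by rewrite mem_enum => /imsetP[i]; case: (no i).
  exists 0; split=> [|i|]; first by rewrite s0.
    by case: (no i).
  by apply: bigmax_le => [|i]; [exact: ltW|case: (no i)].
have q_fix : eval P q = q by case: q_LFP.
have K1 := gain_ge1 P_MPS P_quadratic q_LFP q_gt0 q_le1 i0.
have hb : 2^-1 ^+ h <= (eps / gain P q ^+ depth P) ^+ (2 ^ nonlinear_depth P q) / 8.
  apply: log2_bound h_ge => //.
  - by rewrite invr_gt0 exprn_gt0// (alpha_gt0 P_MPS q_fix q_gt0 i0).
  - by rewrite ltr0n muln_gt0/= (leq_ltn_trans _ (ltn_ord i0)).
  exact: (norm_eval1_gt0 P_MPS P_quadratic q_LFP q_gt0 q_le1 i0).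
have [qt Eqt [qtq qtE]] := rdnm_approximates P_MPS P_quadratic q_LFP q_gt0 q_le1
  eps_gt0 eps_lt1 K1 hb g_ge s_bottom_up.
exists qt; split=> // [i|]; first by case/andP: (qtq i).
apply: bigmax_le => [|i _]; first exact: ltW.
have /andP[_ qi] := qtq i.
rewrite !mxE ger0_norm ?subr_ge0//.
have si : scc_of P i \in s by rewrite (perm_mem ps) mem_enum scc_of_in_sccs.
apply: le_trans (qtE _ _ si (mem_scc_of P i)) _; exact: error_le.
Qed.
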